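(* Let $\varphi,\psi\in L^\infty(\mathbb{D})$. If the commutator $[S_\varphi,S_\psi]=S_\varphi S_\psi-S_\psi S_\varphi$ on $(L_h^2)^\perp$ has finite rank, then the rank of $[S_\varphi,S_\psi]$ is an even number.
   Context: $\mathbb{D}$ is the open unit disk in $\mathbb{C}$, $dA=\frac1\pi\,dx\,dy$ is normalized area measure, and $L^2(\mathbb{D})=L^2(\mathbb{D},dA)$ is the space of (complex-valued) square-integrable functions with inner product $\langle f,g\rangle=\int_{\mathbb{D}} f\overline{g}\,dA$. $L_h^2$ is the harmonic Bergman space, i.e. the closed subspace of $L^2(\mathbb{D})$ consisting of all (complex-valued) harmonic functions on $\mathbb{D}$ in $L^2(\mathbb{D})$; $(L_h^2)^\perp$ is its orthogonal complement in $L^2(\mathbb{D})$, and $Q$ is the orthogonal projection of $L^2(\mathbb{D})$ onto $L_h^2$. For $\varphi\in L^\infty(\mathbb{D})$, the dual Toeplitz operator $S_\varphi$ with symbol $\varphi$ is the bounded linear operator on $(L_h^2)^\perp$ given by $S_\varphi u=(I-Q)(\varphi u)$. The rank of an operator is the dimension of its range. *)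

(* Defs.v *)
From HB Require Import structures.
From mathcomp Require Import all_boot all_order all_algebra.
From mathcomp Require Import complex.
From mathcomp Require Import all_classical all_reals all_analysis.

Set Implicit Arguments.
Unset Strict Implicit.
Unset Printing Implicit Defensive.
Import Order.TTheory GRing.Theory Num.Theory.
Import numFieldNormedType.Exports.

Local Open Scope classical_set_scope.
Local Open Scope ring_scope.

(* The complex plane, as the domain of functions, is identified with R * R via
   (x, y) <-> x + iy; values are taken in R[i].  An element of L^2(D) is
   represented by a function R * R -> R[i], of which only the values on the
   disk matter; equality in L^2(D) is [ae_eqD]. *)

Section dual_toeplitz_operators.
Context {R : realType}.

Local Notation C := R[i].
Local Notation plane := (R * R)%type.
Local Notation mplane := (measurableTypeR R * measurableTypeR R)%type.
Local Notation Re := (@complex.Re R).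
Local Notation Im := (@complex.Im R).
Local Notation modulus := (@Normc.normc R).

Implicit Types (f g h u phi psi : plane -> C) (v : plane -> R).

Definition disk : set plane := [set z | z.1 ^+ 2 + z.2 ^+ 2 < 1].

Definition dA : {measure set mplane -> \bar R} :=
  mscale (NngNum (ltW (divr_gt0 ltr01 (pi_gt0 R))))
    (@lebesgue_measure R \x @lebesgue_measure R)%E.

Definition ae_eqD f g : Prop := {ae dA, forall z, disk z -> f z = g z}.

Definition cmeasurable f : Prop :=
  measurable_fun (disk : set mplane) (Re \o f) /\
  measurable_fun (disk : set mplane) (Im \o f).

Definition Linfty : set (plane -> C) := [set f | cmeasurable f /\
  exists M : R, {ae dA, forall z, disk z -> modulus (f z) <= M}].

Definition L2 : set (plane -> C) := [set f | cmeasurable f /\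
  dA.-integrable disk (fun z => (modulus (f z) ^+ 2)%:E)].

Definition cintegral f : C :=
  Complex (\int[dA]_(z in disk) Re (f z)) (\int[dA]_(z in disk) Im (f z)).

Definition inner f g : C := cintegral (fun z => f z * conjc (g z)).

Definition e1 : plane := (1, 0).
Definition e2 : plane := (0, 1).

Fixpoint classC (k : nat) v : Prop :=
  {in disk, continuous v} /\
  if k is k'.+1 then forall e : plane, e = e1 \/ e = e2 ->
    {in disk, forall z, derivable v z e} /\ classC k' ('D_e v)
  else True.

Definition laplacian v : plane -> R :=
  fun z => 'D_e1 ('D_e1 v) z + 'D_e2 ('D_e2 v) z.

Definition real_harmonicD v : Prop :=
  classC 2 v /\ {in disk, forall z, laplacian v z = 0}.

Definition harmonicD f : Prop :=
  real_harmonicD (Re \o f) /\ real_harmonicD (Im \o f).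

Definition L2h : set (plane -> C) := [set h | harmonicD h /\ L2 h].

Definition L2h_perp : set (plane -> C) :=
  [set f | L2 f /\ forall h, L2h h -> inner f h = 0].

(* L2h_proj f is the element h of L^2_h (unique on the disk) with f - h
   orthogonal to L^2_h; it exists for every f in L^2(D) because L^2_h is
   closed, so the default value 0 only occurs when f is not in L^2(D). *)
Definition L2h_proj f : plane -> C :=
  xget (fun=> 0) [set h | L2h h /\ L2h_perp (fun z => f z - h z)].

Definition dual_toeplitz phi u : plane -> C :=
  fun z => phi z * u z - L2h_proj (fun x => phi x * u x) z.

Definition commutator phi psi u : plane -> C :=
  fun z => dual_toeplitz phi (dual_toeplitz psi u) z
           - dual_toeplitz psi (dual_toeplitz phi u) z.

(* The dimension, as a subspace of L^2(D) (that is, modulo a.e. equality), of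
   a subspace V given by representatives: V has a basis with n elements. *)
Definition has_dim (V : set (plane -> C)) (n : nat) : Prop :=
  exists b : 'I_n -> plane -> C,
  [/\ forall i, V (b i),
      forall c : 'I_n -> C,
        ae_eqD (fun z => \sum_(i < n) c i * b i z) (fun=> 0) ->
        forall i, c i = 0
    & forall f, V f -> exists c : 'I_n -> C,
        ae_eqD f (fun z => \sum_(i < n) c i * b i z)].

Definition has_rank (T : (plane -> C) -> (plane -> C)) (n : nat) : Prop :=
  has_dim (T @` L2h_perp) n.

Definition finite_rank T : Prop := exists n, has_rank T n.

End dual_toeplitz_operators.

(* Main.v *)
Require Import Defs.
From HB Require Import structures.
From mathcomp Require Import all_boot all_order all_algebra.
From mathcomp Require Import complex ring lra.
From mathcomp Require Import all_classical all_reals all_analysis.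
From mathcomp Require Import measurable_realfun.

(** Complex conjugation preserves the harmonic functions, so the form
    bilin f g = \int f g dA, bilinear rather than sesquilinear, makes every dual
    Toeplitz operator symmetric: for u and v orthogonal to L^2_h the projection
    Q (phi u) contributes nothing to bilin (S_phi u) v, which is therefore
    \int phi u v dA ([dual_toeplitz_sym]).  Hence the commutator K is skew for this
    form, bilin (K u) v = - bilin (K v) u ([commutator_skew]).  If b_i = K u_i is a
    basis of the range of K, the matrix of the bilin b_i u_j is skew-symmetric.
    It is invertible: for y in the span of the b_i whose coefficients lie in its
    left kernel, bilin y (conj y) = 0, since bilin b_i (conj y) equals
    - bilin (K (conj y)) u_i and K (conj y) is a combination of the b_j; and
    bilin y (conj y) is the squared norm of y.  An invertible skew-symmetric matrix
    has even size, as its determinant equals its own (-1)^n-th multiple.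

    The analytic content is that S_phi maps the orthogonal complement into itself,
    that is, that the orthogonal projection onto L^2_h exists
    ([rL2h_projection]).  It is obtained from a sequence minimizing the distance, so
    what matters is that L^2 limits of harmonic functions are harmonic.  This rests
    on a mean value formula with a smooth weight: with P_n(w) = (s - |w - z|^2)_+^n,

      \int u P_3 dA = c(s) u(z)     (u harmonic, s small, c(s) > 0 free of z).

    To prove it, integration by parts on horizontal and vertical segments gives
    \int (u \Delta P - P \Delta u) = 0 ([green_identity]), which relates the integrals
    of u P_2 and u P_3; together with d/ds \int u P_3 = 3 \int u P_2 this makes
    \int u P_3 proportional to s^4 ([power_law]), and letting s tend to 0 identifies
    the factor ([reproducing]).  The formula bounds point values by L^2 norms, so
    an L^2-Cauchy sequence of harmonic functions converges pointwise; Fatou's lemma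
    turns this into L^2 convergence, which replaces the completeness of L^2.  The
    limit satisfies the same formula, hence is of class C^2 by differentiation under
    the integral sign, and its Laplacian vanishes because the integrals that compute
    it pass to the limit ([harmonic_L2_limit]). *)

Set Implicit Arguments.
Unset Strict Implicit.
Unset Printing Implicit Defensive.
Import Order.TTheory GRing.Theory Num.Theory.
Import numFieldNormedType.Exports.

Local Open Scope classical_set_scope.
Local Open Scope ring_scope.

(** * Square-integrable functions on the disk *)

Section real_L2.
Context {R : realType}.
Local Notation plane := (R * R)%type.
Local Notation mplane := (measurableTypeR R * measurableTypeR R)%type.
Local Notation lambda := (@lebesgue_measure R).
Implicit Types (f g h u v : plane -> R) (A : set plane).

Lemma measurable_coord1 (D : set mplane) : measurable_fun D (fst : mplane -> R).
Proof. exact: measurable_funTS. Qed.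

Lemma measurable_coord2 (D : set mplane) : measurable_fun D (snd : mplane -> R).
Proof. exact: measurable_funTS. Qed.

Lemma measurable_disk : measurable (disk : set mplane).
Proof.
have : measurable_fun setT (fun z : mplane => (z.1 ^+ 2 + z.2 ^+ 2 : R)).
  apply: measurable_funD; apply: measurable_funX.
    exact: measurable_coord1.
  exact: measurable_coord2.
move=> /(_ measurableT _ (measurable_itv `]-oo, (1:R)[)); rewrite setTI.
by congr measurable; apply/seteqP; split => z /=; rewrite /disk /= in_itv.
Qed.

Lemma disk_bound (z : plane) : disk z -> `|z.1| < 1 /\ `|z.2| < 1.
Proof.
move=> Dz; rewrite -![_ < 1]ltr_sqr ?nnegrE// expr1n !real_normK ?num_real//.
by move: Dz; rewrite /disk/= => Dz; split; nra.
Qed.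

Lemma dA_disk_fin : (dA (disk : set mplane) < +oo)%E.
Proof.
pose S : set mplane := `[-1, 1]%classic `*` `[-1, 1]%classic.
have mS : measurable S by apply: measurableX; exact: measurable_itv.
apply: (@le_lt_trans _ _ (dA S)).
  apply: le_measure; rewrite ?inE//; first exact: measurable_disk.
  move=> z /disk_bound[]; rewrite !ltr_norml => /andP[a b] /andP[c d].
  by split => /=; rewrite in_itv/=; apply/andP; split; apply: ltW.
rewrite /dA /= /mscale /= /S product_measure1E; [|exact: measurable_itv..].
by rewrite /= !lebesgue_measure_itv/= lte_fin gtrN// -!EFinB -!EFinM ltry.
Qed.

Definition L1D f := dA.-integrable (disk : set mplane) (EFin \o f).
Definition rL2 f := measurable_fun (disk : set mplane) f /\ L1D (fun z => f z ^+ 2).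

Lemma L1D_measurable f : L1D f -> measurable_fun (disk : set mplane) f.
Proof. by case/integrableP => /measurable_EFinP. Qed.

Lemma le_L1D f g : measurable_fun (disk : set mplane) f ->
  (forall z, disk z -> `|f z| <= g z) -> L1D g -> L1D f.
Proof.
move=> mf fg ig; apply: (le_integrable measurable_disk _ _ ig).
  exact/measurable_EFinP.
by move=> z Dz /=; rewrite lee_fin (le_trans (fg z Dz))// ler_norm.
Qed.

Lemma L1D_cst (c : R) : L1D (cst c).
Proof.
apply/integrableP; split; first exact/measurable_EFinP/measurable_cst.
rewrite /comp /= integral_cst; last exact: measurable_disk.
by rewrite lte_mul_pinfty// ?lee_fin// dA_disk_fin.
Qed.

Lemma L1DD f g : L1D f -> L1D g -> L1D (fun z => f z + g z).
Proof. by move=> fi gi; apply: (integrableD measurable_disk fi gi). Qed.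

Lemma L1DZ (c : R) f : L1D f -> L1D (fun z => c * f z).
Proof. by move=> fi; apply: (integrableZl measurable_disk c fi). Qed.

Lemma L1DN f : L1D f -> L1D (fun z => - f z).
Proof. by move=> /(L1DZ (-1)); under eq_fun do rewrite mulN1r. Qed.

Lemma L1DB f g : L1D f -> L1D g -> L1D (fun z => f z - g z).
Proof. by move=> fi gi; apply: L1DD => //; exact: L1DN. Qed.

Lemma L1D_bounded M f : measurable_fun (disk : set mplane) f ->
  (forall z, disk z -> `|f z| <= M) -> L1D f.
Proof. by move=> mf fM; apply: (le_L1D mf fM); exact: L1D_cst. Qed.

Lemma L1D_mul_bounded M f g : L1D f -> measurable_fun (disk : set mplane) g ->
  (forall z, disk z -> `|g z| <= M) -> L1D (fun z => f z * g z).
Proof.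
move=> fi mg gM; apply: (@le_L1D _ (fun z => M * `|f z|)).
- by apply: measurable_funM => //; exact: L1D_measurable.
- by move=> z Dz; rewrite normrM mulrC ler_wpM2r// gM.
- apply: L1DZ; exact: (integrable_norm fi).
Qed.

Lemma eq_L1D f g : (forall z, disk z -> f z = g z) -> L1D f -> L1D g.
Proof.
move=> fg; apply: (eq_integrable measurable_disk) => z /set_mem Dz.
by rewrite /= fg.
Qed.

Definition intD f : R := \int[dA]_(z in (disk : set mplane)) f z.

Lemma eq_intD f g : (forall z, disk z -> f z = g z) -> intD f = intD g.
Proof. by move=> fg; apply: eq_Rintegral => z /set_mem/fg. Qed.

Lemma intDD f g : L1D f -> L1D g -> intD (fun z => f z + g z) = intD f + intD g.
Proof. by move=> fi gi; rewrite /intD RintegralD//; exact: measurable_disk. Qed.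

Lemma intDB f g : L1D f -> L1D g -> intD (fun z => f z - g z) = intD f - intD g.
Proof. by move=> fi gi; rewrite /intD RintegralB//; exact: measurable_disk. Qed.

Lemma intDZ c f : L1D f -> intD (fun z => c * f z) = c * intD f.
Proof. by move=> fi; rewrite /intD RintegralZl//; exact: measurable_disk. Qed.

Lemma intD_ge0 f : (forall z, disk z -> 0 <= f z) -> 0 <= intD f.
Proof. by move=> f0; apply: Rintegral_ge0. Qed.

Lemma le_intD f g : L1D f -> L1D g -> (forall z, disk z -> f z <= g z) ->
  intD f <= intD g.
Proof. by move=> fi gi fg; apply: le_Rintegral => //; exact: measurable_disk. Qed.

Lemma norm_intD f : L1D f -> `|intD f| <= intD (fun z => `|f z|).
Proof. by move=> fi; apply: le_normr_Rintegral => //; exact: measurable_disk. Qed.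

Lemma L1D_norm f : L1D f -> L1D (fun z => `|f z|).
Proof. exact: integrable_norm. Qed.

Lemma rL2_measurable f : rL2 f -> measurable_fun (disk : set mplane) f.
Proof. by case. Qed.

Lemma rL2_mul f g : rL2 f -> rL2 g -> L1D (fun z => f z * g z).
Proof.
move=> [mf f2] [mg g2]; apply: (le_L1D _ _ (L1DD f2 g2)).
  exact: measurable_funM.
move=> z _; rewrite ler_norml; apply/andP; split; nra.
Qed.

Lemma rL2D f g : rL2 f -> rL2 g -> rL2 (fun z => f z + g z).
Proof.
move=> Lf Lg; split; first by apply: measurable_funD; apply: rL2_measurable.
have := L1DD (L1DD Lf.2 Lg.2) (L1DZ 2 (rL2_mul Lf Lg)).
by apply: eq_L1D => z _; ring.
Qed.

Lemma rL2Z c f : rL2 f -> rL2 (fun z => c * f z).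
Proof.
move=> Lf; split; first by apply: measurable_funM => //; apply: rL2_measurable.
by apply: (eq_L1D _ (L1DZ (c ^+ 2) Lf.2)) => z _; ring.
Qed.

Lemma rL2B f g : rL2 f -> rL2 g -> rL2 (fun z => f z - g z).
Proof.
move=> Lf Lg; have := rL2D Lf (rL2Z (-1) Lg).
by under eq_fun do rewrite mulN1r.
Qed.

Lemma rL2_bounded M f : measurable_fun (disk : set mplane) f ->
  (forall z, disk z -> `|f z| <= M) -> rL2 f.
Proof.
move=> mf fM; split=> //; apply: (@L1D_bounded (M ^+ 2)).
  exact: measurable_funX.
by move=> z Dz; rewrite normrX lerXn2r ?nnegrE ?fM// (le_trans _ (fM z Dz)).
Qed.

Lemma rL2_cst (c : R) : rL2 (cst c).
Proof. by apply: (@rL2_bounded `|c|). Qed.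

Lemma rL2_L1D f : rL2 f -> L1D f.
Proof.
by move=> Lf; apply: (eq_L1D _ (rL2_mul Lf (rL2_cst 1))) => z _; rewrite mulr1.
Qed.

Lemma intD_sqr_ge0 f : 0 <= intD (fun z => f z ^+ 2).
Proof. by apply: intD_ge0 => z _; exact: sqr_ge0. Qed.

Lemma intD_sqrB t f g : rL2 f -> rL2 g ->
  intD (fun z => (f z - t * g z) ^+ 2) = intD (fun z => f z ^+ 2)
  - 2 * t * intD (fun z => f z * g z) + t ^+ 2 * intD (fun z => g z ^+ 2).
Proof.
move=> Lf Lg; rewrite -(intDZ _ (rL2_mul Lf Lg)) -(intDZ _ Lg.2).
rewrite -intDB; [|exact: Lf.2|exact/L1DZ/rL2_mul].
rewrite -intDD; [|apply: L1DB; [exact: Lf.2|exact/L1DZ/rL2_mul]|exact/L1DZ/Lg.2].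
by apply: eq_intD => z _; ring.
Qed.

Lemma cauchy_schwarzD f g : rL2 f -> rL2 g ->
  intD (fun z => f z * g z) ^+ 2 <=
  intD (fun z => f z ^+ 2) * intD (fun z => g z ^+ 2).
Proof.
move=> Lf Lg.
have H t := intD_sqrB t Lf Lg; have P t := intD_sqr_ge0 (fun z => f z - t * g z).
have a0 := intD_sqr_ge0 f; have b0 := intD_sqr_ge0 g.
move: (intD (fun z => f z * g z)) (intD (fun z => f z ^+ 2))
  (intD (fun z => g z ^+ 2)) H a0 b0 => c a b H a0 b0.
have Q t : 0 <= a - 2 * t * c + t ^+ 2 * b by rewrite -H.
have [b_eq|b_neq] := eqVneq b 0.
  rewrite b_eq mulr0; have [->|c0] := eqVneq c 0; first by rewrite expr0n.
  (* The polynomial in Q is affine in t and takes the value - 1 here. *)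
  have := Q ((a + 1) / (2 * c)); rewrite b_eq mulr0 addr0.
  rewrite (_ : 2 * _ * _ = a + 1); last by field.
  by rewrite opprD addrA subrr add0r oppr_ge0 ler10.
have {b_neq} bp : 0 < b by rewrite lt_def b_neq.
have := Q (c / b); rewrite -(pmulr_rge0 _ bp).
rewrite [X in 0 <= X](_ : _ = a * b - c ^+ 2) ?subr_ge0//.
by field; rewrite gt_eqF.
Qed.

End real_L2.

(** * Functions of class C^k on the disk *)

Section plane_topology.
Context {R : realType}.
Local Notation plane := (R * R)%type.
Local Notation mplane := (measurableTypeR R * measurableTypeR R)%type.
Implicit Types (u v f g : plane -> R) (A : set plane) (z w : plane).

Lemma ball_planeE z (e : R) w :
  ball z e w <-> `|z.1 - w.1| < e /\ `|z.2 - w.2| < e.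
Proof. by split => -[]. Qed.

Lemma open_disk : open (disk : set plane).
Proof.
have : open ((fun z : plane => z.1 ^+ 2 + z.2 ^+ 2) @^-1` `]-oo, (1:R)[%classic).
  apply: open_comp; last exact: interval_open.
  move=> z _; apply: cvgD.
    exact: (continuous_comp (@cvg_fst _ _ _ _ _) (@exprn_continuous R 2 _)).
  exact: (continuous_comp (@cvg_snd _ _ _ _ _) (@exprn_continuous R 2 _)).
by congr open; apply/seteqP; split => z /=; rewrite /disk /= in_itv.
Qed.

Lemma near_disk z : disk z -> \near z, disk z.
Proof. by move=> Dz; apply: open_nbhs_nbhs; split => //; exact: open_disk. Qed.

(** The product sigma-algebra contains the open sets because these are countable
    unions of rational boxes. *)
Lemma open_measurable_plane A : open A -> measurable (A : set mplane).
Proof.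
move=> oA.
pose B (q : rat * rat * nat) : set mplane :=
  ball (ratr q.1.1 : R) (q.2.+1%:R^-1) `*` ball (ratr q.1.2 : R) (q.2.+1%:R^-1).
pose P := [set q | B q `<=` A].
have -> : A = \bigcup_(q in P) B q.
  apply/seteqP; split => [z Az|z [q Pq Bq]]; last exact: Pq.
  have /nbhs_ballP[e /= e0 eA] : nbhs z A by apply: open_nbhs_nbhs.
  have [n ne] : exists n, (n.+1%:R^-1 : R) < e / 2.
    have e20 : 0 < e / 2 by rewrite divr_gt0.
    have [n _ /(_ n (leqnn _)) h] := near_infty_natSinv_lt (PosNum e20).
    by exists n.
  have n0 : 0 < (n.+1%:R^-1 : R) by rewrite invr_gt0.
  have rat_near (x : R) : exists p : rat, `|ratr p - x| < n.+1%:R^-1.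
    have [p] := @rat_in_itvoo R (x - n.+1%:R^-1) (x + n.+1%:R^-1) ltac:(by rewrite ltrD2l gtrN).
    by rewrite in_itv/= => /andP[p1 p2]; exists p; rewrite ltr_distl p1.
  have [p pP] := rat_near z.1; have [q qP] := rat_near z.2.
  exists (p, q, n); last by split.
  move=> w [] /=; rewrite /ball/= => wp wq.
  apply: eA; apply/ball_planeE; split.
    rewrite (le_lt_trans (ler_distD (ratr p) _ _))// [e]splitr ltrD//.
      by rewrite distrC (lt_trans pP).
    by rewrite (lt_trans wp).
  rewrite (le_lt_trans (ler_distD (ratr q) _ _))// [e]splitr ltrD//.
    by rewrite distrC (lt_trans qP).
  by rewrite (lt_trans wq).
rewrite bigcup_mkcond; apply: countable_bigcupT_measurable.
  exact: countableP.
move=> q.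
case: ifPn => // _; apply: measurableX; apply: open_measurable; exact: ball_open.
Qed.

Lemma continuous_disk_measurable v :
  {in disk, continuous v} -> measurable_fun (disk : set mplane) v.
Proof.
move=> cv; apply: (measurability _ (RGenOInfty.measurableE R)).
move=> /= _ [_ [a ->] <-]; apply: open_measurable_plane.
rewrite openE => z [Dz /=]; rewrite in_itv/= andbT => az.
rewrite /interior/=; near=> w; split; first by near: w; exact: near_disk.
rewrite /= in_itv/= andbT; near: w; apply: (cvgr_gt (v z)) => //.
by apply: cv; rewrite inE.
Unshelve. all: by end_near. Qed.

Lemma growth_slice1 v z : (fun h => h^-1 *: ((v \o shift z) (h *: e1) - v z)) =
  (fun h => h^-1 *: (((fun t => v (t, z.2)) \o shift z.1) (h *: (1:R)) - v (z.1, z.2))).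
Proof.
apply/funext => h /=; rewrite -surjective_pairing; congr (_ *: (v _ - _)).
by rewrite /shift/=; case: z => x y /=; congr pair; rewrite /e1 /= scaler0 add0r.
Qed.

Lemma growth_slice2 v z : (fun h => h^-1 *: ((v \o shift z) (h *: e2) - v z)) =
  (fun h => h^-1 *: (((fun t => v (z.1, t)) \o shift z.2) (h *: (1:R)) - v (z.1, z.2))).
Proof.
apply/funext => h /=; rewrite -surjective_pairing; congr (_ *: (v _ - _)).
by rewrite /shift/=; case: z => x y /=; congr pair; rewrite /e2 /= scaler0 add0r.
Qed.

(** Partial derivatives only see one coordinate line, which reduces them to
    one-variable calculus. *)
Lemma is_derive_slice1 v z (l : R) :
  is_derive z.1 1 (fun t => v (t, z.2)) l <-> is_derive z e1 v l.
Proof.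
split=> -[dv <-].
  by apply: DeriveDef; rewrite ?/derivable ?/derive growth_slice1.
by apply: DeriveDef; rewrite ?/derivable ?/derive -growth_slice1.
Qed.

Lemma is_derive_slice2 v z (l : R) :
  is_derive z.2 1 (fun t => v (z.1, t)) l <-> is_derive z e2 v l.
Proof.
split=> -[dv <-].
  by apply: DeriveDef; rewrite ?/derivable ?/derive growth_slice2.
by apply: DeriveDef; rewrite ?/derivable ?/derive -growth_slice2.
Qed.

Lemma near_near_eq (f g : plane -> R) z :
  (\near z, f z = g z) -> \near z, \near z, f z = g z.
Proof. exact: nbhs_interior. Qed.

Lemma near_eq_continuous f g z : (\near z, f z = g z) ->
  {for z, continuous f} -> {for z, continuous g}.
Proof.
move=> fg; rewrite /prop_for /continuous_at => cf; rewrite -(nbhs_singleton fg).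
by apply: cvg_trans cf; apply: near_eq_cvg.
Qed.

(** The analogue of [classC] on the whole plane, with the partial derivatives
    presented as explicit functions; it is easier to establish for integrals
    depending on parameters. *)
Fixpoint globalC (k : nat) g : Prop :=
  continuous g /\
  if k is k'.+1 then exists g1 g2,
    [/\ forall z, is_derive z e1 g (g1 z), forall z, is_derive z e2 g (g2 z),
        globalC k' g1 & globalC k' g2]
  else True.

(** Smoothness on the disk is local, so it may be checked on a different smooth
    model near each point. *)
Lemma classC_local k v : (forall z, disk z -> exists2 g, globalC k g &
  \near z, g z = v z) -> classC k v.
Proof.
elim: k v => [|k IH] v H /=.
  split=> // z /set_mem /H[g [cg _] gv]; exact: near_eq_continuous (cg z).
split; first by move=> z /set_mem /H[g [cg _] gv]; exact: near_eq_continuous (cg z).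
move=> e eE; split.
  move=> z /set_mem /H[g [_ [g1 [g2 [d1 d2 _ _]]]] gv].
  apply: near_eq_derivable; first exact: gv.
  by case: eE => ->; exact: ex_derive.
apply: IH => z /H[g [_ [g1 [g2 [d1 d2 C1 C2]]]] gv].
have gv' := near_near_eq gv.
case: eE => ->; [exists g1 => //|exists g2 => //]; near=> w;
  rewrite -(@near_eq_derive _ _ _ g v); first last.
- by near: w; apply: gv'.
- by rewrite derive_val.
- by near: w; apply: gv'.
- by rewrite derive_val.
Unshelve. all: by end_near. Qed.

Lemma eq_classC k f g : (forall z, disk z -> f z = g z) ->
  classC k f -> classC k g.
Proof.
elim: k f g => [|k IH] f g fg /=.
  case=> cf _; split=> // z zD; apply: near_eq_continuous (cf z zD).
  by near=> w; apply: fg; near: w; apply/near_disk/set_mem.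
have nfg z : disk z -> \near z, f z = g z.
  by move=> Dz; near=> w; apply: fg; near: w; exact/near_disk.
case=> cf df; split=> [z zD|e eE].
  exact: near_eq_continuous (nfg _ (set_mem zD)) (cf z zD).
have [ddf C] := df e eE; split=> [z zD|].
  by apply: near_eq_derivable (ddf z zD); exact/nfg/set_mem.
by apply: IH C => z Dz; apply: near_eq_derive; exact: nfg.
Unshelve. all: by end_near. Qed.

Lemma derive_addZ (t : R) f g z e : derivable f z e -> derivable g z e ->
  is_derive z e (fun w => f w + t * g w) ('D_e f z + t * 'D_e g z).
Proof.
move=> /derivableP df /derivableP dg.
exact: (is_deriveD df (is_deriveZ t dg)).
Qed.

Lemma classC_addZ (t : R) k f g : classC k f -> classC k g ->
  classC k (fun z => f z + t * g z).
Proof.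
elim: k f g => [|k IH] f g /= [cf df] [cg dg].
  split=> // z zD; apply: cvgD; first exact: cf.
  by apply: cvgM; [exact: cvg_cst|exact: cg].
split=> [z zD|e eE].
  by apply: cvgD; [exact: cf|apply: cvgM; [exact: cvg_cst|exact: cg]].
have [df1 Cf] := df e eE; have [dg1 Cg] := dg e eE; split=> [z zD|].
  by apply: ex_derive; apply: derive_addZ; [exact: df1|exact: dg1].
apply: eq_classC (IH _ _ Cf Cg) => z /mem_set zD.
by apply/esym; rewrite (derive_val (is_derive := derive_addZ t (df1 z zD) (dg1 z zD))).
Qed.

Lemma classC_continuous k v : classC k v -> {in disk, continuous v}.
Proof. by case: k => [|k] []. Qed.

Lemma classC_derivable k v e : e = e1 \/ e = e2 -> classC k.+1 v ->
  {in disk, forall z, derivable v z e}.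
Proof. by move=> eE [_ /(_ e eE)[]]. Qed.

Lemma classC_derive k v e : e = e1 \/ e = e2 -> classC k.+1 v ->
  classC k ('D_e v).
Proof. by move=> eE [_ /(_ e eE)[]]. Qed.

Lemma harmonic_addZ (t : R) f g : real_harmonicD f -> real_harmonicD g ->
  real_harmonicD (fun z => f z + t * g z).
Proof.
move=> [Cf Lf] [Cg Lg]; split; first exact: classC_addZ.
move=> z zD; rewrite /laplacian.
have H e : e = e1 \/ e = e2 -> 'D_e ('D_e (fun z => f z + t * g z)) z =
    'D_e ('D_e f) z + t * 'D_e ('D_e g) z.
  move=> eE; rewrite -(derive_val (is_derive := derive_addZ t
    (classC_derivable eE (classC_derive eE Cf) zD)
    (classC_derivable eE (classC_derive eE Cg) zD))).
  apply: near_eq_derive; near=> w.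
  have wD : w \in disk by rewrite inE; near: w; exact/near_disk/set_mem.
  by rewrite (derive_val (is_derive := derive_addZ t
    (classC_derivable eE Cf wD) (classC_derivable eE Cg wD))).
rewrite (H e1); last by left.
rewrite (H e2); last by right.
have := Lf z zD; have := Lg z zD; rewrite /laplacian => lg lf.
rewrite addrACA lf -mulrDr lg; ring.
Unshelve. all: by end_near. Qed.

Lemma classC_cst k (c : R) : classC k (cst c : plane -> R).
Proof.
apply: classC_local => z _; exists (cst c); last by near=> w.
elim: k c => [|k IH] c /=; first by split=> // w; exact: cvg_cst.
split; first by move=> w; exact: cvg_cst.
by exists (cst 0), (cst 0); split=> // w; exact: is_derive_cst.
Unshelve. all: by end_near. Qed.

Lemma harmonic_cst (c : R) : real_harmonicD (cst c : plane -> R).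
Proof.
split=> [|z _]; first exact: classC_cst.
have H e : 'D_e (cst c : plane -> R) = cst 0 by apply/funext => w; exact: derive_cst.
by rewrite /laplacian !H !derive_cst addr0.
Qed.

End plane_topology.

(** * Moments of a truncated power *)

Section bump.
Context {R : realType}.
Local Notation plane := (R * R)%type.
Local Notation mplane := (measurableTypeR R * measurableTypeR R)%type.
Implicit Types (u v f g : plane -> R) (A : set plane) (z w : plane).
Lemma maxr0E (x : R) : Num.max 0 x = (x + `|x|) / 2.
Proof.
by have [x0|x0] := leP 0 x; [rewrite ger0_norm//|rewrite ltr0_norm//]; lra.
Qed.

Definition pospow (n : nat) (x : R) : R := Num.max 0 x ^+ n.

Lemma pospow_ge0 n x : 0 <= pospow n x.
Proof. by rewrite exprn_ge0// le_max lexx. Qed.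

Lemma pospow_le0 n x : x <= 0 -> pospow n.+1 x = 0.
Proof. by move=> x0; rewrite /pospow max_l// expr0n. Qed.

Lemma pospow_pos n x : 0 <= x -> pospow n x = x ^+ n.
Proof. by move=> x0; rewrite /pospow max_r. Qed.

Lemma pospowS n x : x * pospow n.+1 x = pospow n.+2 x.
Proof.
have [x0|x0] := leP 0 x; first by rewrite !pospow_pos// exprS.
by rewrite !pospow_le0 ?mulr0// ltW.
Qed.

Lemma is_derive_exprn n (x : R) : is_derive x 1 (fun y => y ^+ n) (n%:R * x ^+ n.-1).
Proof.
have -> : (fun y : R => y ^+ n) = (id : R -> R) ^+ n by rewrite exprfctE.
by apply: is_derive_eq; rewrite /GRing.scale/= mulr1.
Qed.

Lemma is_derive_subX (a : R) n (x : R) :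
  is_derive x 1 (fun y => (a - y) ^+ n) (- n%:R * (a - x) ^+ n.-1).
Proof.
have D : is_derive x 1 (fun y => a - y) (-1) by apply: is_derive_eq; ring.
by apply: is_derive_eq (is_derive1_comp (is_derive_exprn n _) D) _; rewrite mulrN1 mulNr.
Qed.

(** At 0 the difference quotient is at most |h|^(n+1), so the truncation does not
    destroy differentiability from the second power on. *)
Lemma is_derive_pospow n (x : R) : is_derive x 1 (pospow n.+2) (n.+2%:R * pospow n.+1 x).
Proof.
have [x0|x0|->] := ltgtP x 0.
- apply: (near_eq_is_derive (f := cst 0)).
    by near=> y; rewrite pospow_le0//=; near: y; exact: (@cvgr_le _ _ (nbhs x) _ id x cvg_id).
  by rewrite pospow_le0 ?mulr0 ?ltW//; exact: is_derive_cst.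
- apply: (@near_eq_is_derive _ _ _ (fun y : R => y ^+ n.+2)).
    near=> y; rewrite pospow_pos//.
    by near: y; exact: (@cvgr_ge _ _ (nbhs x) _ id x cvg_id).
  by rewrite pospow_pos ?ltW//; exact: is_derive_exprn.
rewrite pospow_le0// mulr0.
have H : (fun h : R => h^-1 *: ((pospow n.+2 \o shift 0) (h *: 1) - pospow n.+2 0))
   @ 0^' --> (0:R).
  apply/cvgr0Pnorm_le => e e0; near=> h.
  rewrite /= /shift/= addr0 (pospow_le0 _ (lexx 0)) subr0 /GRing.scale/= mulr1.
  have h0 : h != 0 by near: h; exact: nbhs_dnbhs_neq.
  rewrite normrM normfV ger0_norm ?pospow_ge0//.
  rewrite ler_pdivrMl ?normr_gt0//.
  have [hn|hp] := leP h 0; first by rewrite pospow_le0// mulr_ge0// ltW.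
  rewrite (pospow_pos _ (ltW hp)) (exprS h) (gtr0_norm hp); apply: (ler_wpM2l (ltW hp)).
  have he : h <= Num.min e 1.
    rewrite -(gtr0_norm hp); near: h; apply: dnbhs0_le.
    by rewrite lt_min e0 ltr01.
  move: he; rewrite le_min => /andP[he h1].
  by apply: le_trans he; rewrite exprS ler_piMr ?(ltW hp)// exprn_ile1 ?(ltW hp).
apply: DeriveDef; first by apply/cvg_ex; exists 0.
exact: cvg_lim H.
Unshelve. all: by end_near. Qed.

(** The span of these functions for varying i, j and n is closed under
    differentiation, which is why the monomials in w - z accompany the radial
    factor. *)
Definition bump_moment (i j n : nat) (s : R) z w : R :=
  (w.1 - z.1) ^+ i * (w.2 - z.2) ^+ j *
  pospow n (s - (w.1 - z.1) ^+ 2 - (w.2 - z.2) ^+ 2).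

Lemma is_derive_bump_moment1 i j n s (t y : R) w :
  is_derive t 1 (fun x => bump_moment i j n.+2 s (x, y) w)
   (2 * n.+2%:R * bump_moment i.+1 j n.+1 s (t, y) w - i%:R * bump_moment i.-1 j n.+2 s (t, y) w).
Proof.
rewrite /bump_moment /=.
have D1 : is_derive t 1 (fun x => s - (w.1 - x) ^+ 2 - (w.2 - y) ^+ 2) (2 * (w.1 - t)).
  apply: is_derive_eq; rewrite /GRing.scale/=; ring.
have D2 := is_derive1_comp (is_derive_pospow n _) D1.
have D3 (c : R) : is_derive t 1 (fun x => (w.1 - x) ^+ i * c)
  (- i%:R * (w.1 - t) ^+ i.-1 * c).
  apply: is_derive_eq (is_deriveM (is_derive_subX w.1 i t) (is_derive_cst c t 1)) _.
  rewrite /cst /GRing.scale/=; ring.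
apply: (is_derive_eq (is_deriveM (D3 _) D2)); rewrite /GRing.scale/= [in RHS]exprS; ring.
Qed.

Lemma is_derive_bump_moment2 i j n s (t x : R) w :
  is_derive t 1 (fun y => bump_moment i j n.+2 s (x, y) w)
   (2 * n.+2%:R * bump_moment i j.+1 n.+1 s (x, t) w - j%:R * bump_moment i j.-1 n.+2 s (x, t) w).
Proof.
rewrite /bump_moment /=.
have D1 : is_derive t 1 (fun y => s - (w.1 - x) ^+ 2 - (w.2 - y) ^+ 2) (2 * (w.2 - t)).
  apply: is_derive_eq; rewrite /GRing.scale/=; ring.
have D2 := is_derive1_comp (is_derive_pospow n _) D1.
have D3 (c : R) : is_derive t 1 (fun y => c * (w.2 - y) ^+ j)
  (- j%:R * c * (w.2 - t) ^+ j.-1).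
  apply: is_derive_eq (is_deriveM (is_derive_cst c t 1) (is_derive_subX w.2 j t)) _.
  rewrite /cst /GRing.scale/=; ring.
apply: (is_derive_eq (is_deriveM (D3 _) D2)); rewrite /GRing.scale/= [in RHS](exprS _ j); ring.
Qed.

Lemma is_derive_bump_moment_s i j n (t : R) z w :
  is_derive t 1 (fun s => bump_moment i j n.+2 s z w) (n.+2%:R * bump_moment i j n.+1 t z w).
Proof.
rewrite /bump_moment /=.
have D1 : is_derive t 1 (fun s => s - (w.1 - z.1) ^+ 2 - (w.2 - z.2) ^+ 2) 1.
  by apply: is_derive_eq; rewrite !subr0.
have D2 := is_derive1_comp (is_derive_pospow n _) D1.
apply: (is_derive_eq (is_deriveZ ((w.1 - z.1) ^+ i * (w.2 - z.2) ^+ j) D2)).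
rewrite /GRing.scale/=; ring.
Qed.

Lemma measurable_bump_moment i j n s z : measurable_fun (disk : set mplane) (bump_moment i j n s z).
Proof.
have m1 : measurable_fun (disk : set mplane) (fun w : mplane => w.1 - z.1 : R).
  by apply: measurable_funB => //; exact: measurable_coord1.
have m2 : measurable_fun (disk : set mplane) (fun w : mplane => w.2 - z.2 : R).
  by apply: measurable_funB => //; exact: measurable_coord2.
apply: measurable_funM.
  by apply: measurable_funM; apply: measurable_funX.
apply: measurable_funX; apply: measurable_maxr => //.
apply: measurable_funB; last exact: measurable_funX.
by apply: measurable_funB => //; exact: measurable_funX.
Qed.

Lemma bump_moment_bound i j n (B : R) s z w : `|s| <= B -> `|z.1| <= B -> `|z.2| <= B ->
  disk w -> `|bump_moment i j n s z w| <= (1 + B) ^+ i * (1 + B) ^+ j * B ^+ n.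
Proof.
move=> sB z1B z2B /disk_bound[w1 w2].
have B0 : 0 <= B by exact: le_trans sB.
have b1 : `|w.1 - z.1| <= 1 + B by rewrite (le_trans (ler_normB _ _))// lerD// ltW.
have b2 : `|w.2 - z.2| <= 1 + B by rewrite (le_trans (ler_normB _ _))// lerD// ltW.
have b3 : `|pospow n (s - (w.1 - z.1) ^+ 2 - (w.2 - z.2) ^+ 2)| <= B ^+ n.
  rewrite ger0_norm ?pospow_ge0// lerXn2r ?nnegrE ?le_max ?lexx//.
  rewrite ge_max B0 (le_trans _ sB)// (le_trans _ (ler_norm _))//.
  by rewrite -addrA gerDl -opprD oppr_le0 addr_ge0 ?sqr_ge0.
have B1 : 0 <= 1 + B by rewrite addr_ge0.
rewrite /bump_moment (normrM (_ * _)) (normrM (_ ^+ i)) !(normrX _ (_ - _)).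
apply: ler_pM; rewrite ?mulr_ge0 ?exprn_ge0//.
by apply: ler_pM; rewrite ?exprn_ge0// lerXn2r ?nnegrE.
Qed.

(** Boundedness and a Lipschitz estimate in the parameter, uniform in the
    integration variable: both are needed to multiply such families. *)
Definition uniform_lip (k : plane -> plane -> R) z := exists M L : R,
  forall a b w, ball z 1 a -> ball z 1 b -> disk w ->
   `|k a w| <= M /\ `|k a w - k b w| <= L * (`|a.1 - b.1| + `|a.2 - b.2|).

Lemma uniform_lip_cst (c : R) z : uniform_lip (fun _ _ => c) z.
Proof.
by exists `|c|, 0 => a b w _ _ _; split; rewrite ?subrr ?normr0 ?mul0r.
Qed.

Lemma uniform_lipM k l z : uniform_lip k z -> uniform_lip l z ->
  uniform_lip (fun a w => k a w * l a w) z.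
Proof.
move=> [M [L H]] [M' [L' H']]; exists (M * M'), (L * M' + M * L') => a b w za zb Dw.
have [h1 h2] := H a b w za zb Dw; have [h1' h2'] := H' a b w za zb Dw.
have [h3 _] := H b b w zb zb Dw; split; first by rewrite normrM ler_pM.
rewrite (_ : _ - _ = (k a w - k b w) * l a w + k b w * (l a w - l b w)); last by ring.
rewrite (le_trans (ler_normD _ _))// [leRHS]mulrDl; apply: lerD; rewrite normrM.
  by rewrite mulrAC ler_pM.
by rewrite -mulrA ler_pM.
Qed.

Lemma uniform_lipX n k z : uniform_lip k z -> uniform_lip (fun a w => k a w ^+ n) z.
Proof.
move=> kl; elim: n => [|n IH]; first exact: uniform_lip_cst.
by under eq_fun do under eq_fun do rewrite exprS; exact: uniform_lipM.
Qed.

Lemma uniform_lipB k l z : uniform_lip k z -> uniform_lip l z ->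
  uniform_lip (fun a w => k a w - l a w) z.
Proof.
move=> [M [L H]] [M' [L' H']]; exists (M + M'), (L + L') => a b w za zb Dw.
have [h1 h2] := H a b w za zb Dw; have [h1' h2'] := H' a b w za zb Dw.
split; first by rewrite (le_trans (ler_normB _ _))// lerD.
rewrite (_ : _ - _ = (k a w - k b w) - (l a w - l b w)); last by ring.
by rewrite (le_trans (ler_normB _ _))// mulrDl lerD.
Qed.

Lemma uniform_lip_max0 k z : uniform_lip k z -> uniform_lip (fun a w => Num.max 0 (k a w)) z.
Proof.
move=> [M [L H]]; exists M, L => a b w za zb Dw.
have [h1 h2] := H a b w za zb Dw.
split; first by rewrite ger0_norm ?le_max ?lexx// ge_max (le_trans _ h1)//= (le_trans (ler_norm _)).
apply: le_trans h2; rewrite !maxr0E.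
rewrite (_ : _ - _ = ((k a w - k b w) + (`|k a w| - `|k b w|)) / 2); last by ring.
rewrite normrM (ger0_norm (x := 2^-1))// ler_pdivrMr// (le_trans (ler_normD _ _))//.
by rewrite mulr_natr mulr2n lerD2l ler_dist_dist.
Qed.

Lemma uniform_lip_bump_moment i j n s z : uniform_lip (bump_moment i j n s) z.
Proof.
have l1 : uniform_lip (fun a w => w.1 - a.1) z.
  exists (1 + (`|z.1| + 1)), 1 => a b w [za _] _ /disk_bound[w1 _]; split.
    rewrite (le_trans (ler_normB _ _))// lerD// ?ltW//.
    rewrite (_ : a.1 = z.1 - (z.1 - a.1)); last by ring.
    by apply: (le_lt_trans (ler_normB _ _)); rewrite ltrD2l.
  by rewrite mul1r opprB addrC addrA subrK distrC lerDl.
have l2 : uniform_lip (fun a w => w.2 - a.2) z.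
  exists (1 + (`|z.2| + 1)), 1 => a b w [_ za] _ /disk_bound[_ w1]; split.
    rewrite (le_trans (ler_normB _ _))// lerD// ?ltW//.
    rewrite (_ : a.2 = z.2 - (z.2 - a.2)); last by ring.
    by apply: (le_lt_trans (ler_normB _ _)); rewrite ltrD2l.
  by rewrite mul1r opprB addrC addrA subrK distrC lerDr.
apply: uniform_lipM; first by apply: uniform_lipM; exact: uniform_lipX.
apply/uniform_lipX/uniform_lip_max0/uniform_lipB; last exact: uniform_lipX.
by apply: uniform_lipB; [exact: uniform_lip_cst|exact: uniform_lipX].
Qed.

End bump.

(** * Integrals against the moments *)

Section potential.
Context {R : realType}.
Local Notation plane := (R * R)%type.
Local Notation mplane := (measurableTypeR R * measurableTypeR R)%type.
Implicit Types (u v f g : plane -> R) (A : set plane) (z w : plane).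

Definition potential u (i j n : nat) (s : R) z : R :=
  intD (fun w => u w * bump_moment i j n s z w).

Lemma bump_moment_bounded i j n s z :
  exists M : R, forall w, disk w -> `|bump_moment i j n s z w| <= M.
Proof.
exists ((1 + (`|s| + `|z.1| + `|z.2|)) ^+ i * (1 + (`|s| + `|z.1| + `|z.2|)) ^+ j
  * (`|s| + `|z.1| + `|z.2|) ^+ n) => w.
apply: bump_moment_bound; last by rewrite lerDr addr_ge0.
  by rewrite -addrA lerDl addr_ge0.
by rewrite addrAC lerDr addr_ge0.
Qed.

Lemma bump_moment_rL2 i j n s z : rL2 (bump_moment i j n s z).
Proof.
by have [M /(rL2_bounded (measurable_bump_moment i j n s z))] := bump_moment_bounded i j n s z.
Qed.

Lemma L1D_bump_moment u i j n s z : L1D u -> L1D (fun w => u w * bump_moment i j n s z w).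
Proof.
have [M kM] := bump_moment_bounded i j n s z.
by move=> u1; apply: L1D_mul_bounded u1 (measurable_bump_moment i j n s z) kM.
Qed.

(** Differentiation under the integral sign, for an integrable density against a
    kernel whose derivative is bounded near the parameter. *)
Lemma is_derive_intD u (k k' : R -> plane -> R) (t M : R) : L1D u ->
  (forall x, L1D (fun w => u w * k x w)) ->
  (forall (x : R) w, is_derive x 1 (k^~ w) (k' x w)) ->
  (forall x w, `|x - t| < 1 -> disk w -> `|k' x w| <= M) ->
  is_derive t 1 (fun x => intD (fun w => u w * k x w))
    (intD (fun w => u w * k' t w)).
Proof.
move=> u1 k1 dk kM.
pose f (x : R) w := u w * k x w; pose G w := `|M| * `|u w|.
have df (x : R) w : is_derive x 1 (f^~ w) (u w * k' x w) by exact: is_deriveZ.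
have dfE x w : partial1of2 f x w = u w * k' x w by rewrite partial1of2E derive_val.
have It : `]t - 1, t + 1[%classic t by rewrite /= in_itv/= ltrBlDr ltrDl ltr01.
have Hf x : `]t - 1, t + 1[%classic x -> dA.-integrable (disk : set mplane) (EFin \o f x).
  by move=> _; exact: k1.
have Hd x w : `]t - 1, t + 1[%classic x -> disk w -> derivable (f^~ w) x 1.
  by move=> _ _; exact: ex_derive.
have HG : dA.-integrable (disk : set mplane) (EFin \o G).
  by apply/L1DZ/L1D_norm.
have HM x w : `]t - 1, t + 1[%classic x -> disk w -> `|partial1of2 f x w| <= G w.
  rewrite /= in_itv/= -ltr_distl => xt Dw; rewrite dfE normrM mulrC.
  by rewrite ler_wpM2r// (le_trans (kM _ _ xt Dw))// ler_norm.
have G0 w : 0 <= G w by rewrite mulr_ge0.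
apply: DeriveDef.
  exact: (derivable_under_integral measurable_disk It Hf Hd G0 HG HM).
rewrite -derive1E (differentiation_under_integral measurable_disk It Hf Hd G0 HG HM).
by apply: eq_intD => w Dw; rewrite -dfE.
Qed.

Lemma intD_bump_moment_comb u (a b : R) i j n i' j' n' s z : L1D u ->
  intD (fun w => u w * (a * bump_moment i j n s z w - b * bump_moment i' j' n' s z w)) =
  a * potential u i j n s z - b * potential u i' j' n' s z.
Proof.
move=> u1; rewrite /potential -!intDZ; [|exact: L1D_bump_moment..].
rewrite -intDB; [|exact/L1DZ/L1D_bump_moment..].
by apply: eq_intD => w _; ring.
Qed.

Lemma abs_near_bound (x t : R) : `|x - t| < 1 -> `|x| <= `|t| + 1.
Proof.
move=> xt; rewrite -(subrK t x) (le_trans (ler_normD _ _))// addrC lerD2l.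
exact: ltW.
Qed.

Lemma is_derive_potential1 u i j n s z : L1D u ->
  is_derive z e1 (potential u i j n.+2 s)
    (2 * n.+2%:R * potential u i.+1 j n.+1 s z - i%:R * potential u i.-1 j n.+2 s z).
Proof.
move=> u1; apply/is_derive_slice1; rewrite -intD_bump_moment_comb//.
pose B := `|s| + (`|z.1| + 1) + `|z.2|.
pose M := 2 * n.+2%:R * ((1 + B) ^+ i.+1 * (1 + B) ^+ j * B ^+ n.+1) +
  i%:R * ((1 + B) ^+ i.-1 * (1 + B) ^+ j * B ^+ n.+2).
have zE : z = (z.1, z.2) by case: (z).
rewrite [in X in is_derive _ _ _ X]zE.
apply: (is_derive_intD (k := fun x => bump_moment i j n.+2 s (x, z.2))
  (k' := fun x w => 2 * n.+2%:R * bump_moment i.+1 j n.+1 s (x, z.2) w -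
    i%:R * bump_moment i.-1 j n.+2 s (x, z.2) w) (M := M)) => //.
- by move=> x; exact: L1D_bump_moment.
- by move=> x w; exact: is_derive_bump_moment1.
move=> x w /abs_near_bound xz Dw.
have b1 : `|s| <= B by rewrite /B -addrA lerDl !addr_ge0.
have b2 : `|x| <= B by rewrite (le_trans xz)// /B addrAC lerDr addr_ge0.
have b3 : `|z.2| <= B by rewrite /B lerDr !addr_ge0.
rewrite (le_trans (ler_normB _ _))// lerD// normrM ger0_norm// ler_wpM2l//;
 exact: bump_moment_bound.
Qed.

Lemma is_derive_potential2 u i j n s z : L1D u ->
  is_derive z e2 (potential u i j n.+2 s)
    (2 * n.+2%:R * potential u i j.+1 n.+1 s z - j%:R * potential u i j.-1 n.+2 s z).
Proof.
move=> u1; apply/is_derive_slice2; rewrite -intD_bump_moment_comb//.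
pose B := `|s| + (`|z.2| + 1) + `|z.1|.
pose M := 2 * n.+2%:R * ((1 + B) ^+ i * (1 + B) ^+ j.+1 * B ^+ n.+1) +
  j%:R * ((1 + B) ^+ i * (1 + B) ^+ j.-1 * B ^+ n.+2).
have zE : z = (z.1, z.2) by case: (z).
rewrite [in X in is_derive _ _ _ X]zE.
apply: (is_derive_intD (k := fun x => bump_moment i j n.+2 s (z.1, x))
  (k' := fun x w => 2 * n.+2%:R * bump_moment i j.+1 n.+1 s (z.1, x) w -
    j%:R * bump_moment i j.-1 n.+2 s (z.1, x) w) (M := M)) => //.
- by move=> x; exact: L1D_bump_moment.
- by move=> x w; exact: is_derive_bump_moment2.
move=> x w /abs_near_bound xz Dw.
have b1 : `|s| <= B by rewrite /B -addrA lerDl !addr_ge0.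
have b2 : `|x| <= B by rewrite (le_trans xz)// /B addrAC lerDr addr_ge0.
have b3 : `|z.1| <= B by rewrite /B lerDr !addr_ge0.
rewrite (le_trans (ler_normB _ _))// lerD// normrM ger0_norm// ler_wpM2l//;
 exact: bump_moment_bound.
Qed.

Lemma is_derive_potential_s u i j n z (t : R) : L1D u ->
  is_derive t 1 (fun s => potential u i j n.+2 s z)
    (n.+2%:R * potential u i j n.+1 t z).
Proof.
move=> u1; rewrite /potential -intDZ; last exact: L1D_bump_moment.
rewrite [X in is_derive _ _ _ X](@eq_intD _ _
  (fun w => u w * (n.+2%:R * bump_moment i j n.+1 t z w))); last by move=> w _; ring.
pose B := (`|t| + 1) + `|z.1| + `|z.2|.
apply: (is_derive_intD (k := fun s => bump_moment i j n.+2 s z)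
  (k' := fun s w => n.+2%:R * bump_moment i j n.+1 s z w)
  (M := n.+2%:R * ((1 + B) ^+ i * (1 + B) ^+ j * B ^+ n.+1))) => //.
- by move=> x; exact: L1D_bump_moment.
- by move=> x w; exact: is_derive_bump_moment_s.
move=> x w /abs_near_bound xz Dw.
have b1 : `|x| <= B by rewrite (le_trans xz)// /B -(addrA (_ + 1)) lerDl addr_ge0.
have b2 : `|z.1| <= B by rewrite /B addrAC lerDr !addr_ge0.
have b3 : `|z.2| <= B by rewrite /B lerDr !addr_ge0.
rewrite normrM ger0_norm// ler_wpM2l//; exact: bump_moment_bound.
Qed.

Lemma continuous_potential u i j n s : L1D u -> continuous (potential u i j n s).
Proof.
move=> u1 z; have [M [L H]] := uniform_lip_bump_moment i j n s z.
pose I := intD (fun w => `|u w|).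
apply/cvgrPdist_le => e e0.
have I0 : 0 <= I by apply: intD_ge0.
have C0 : 0 < 2 * (I * `|L| + 1) by rewrite mulr_gt0// ltr_wpDl ?mulr_ge0.
have nb1 : \forall a \near z, ball z 1 a by exact: nbhsx_ballx.
have nb2 : \forall a \near z, ball z (e / (2 * (I * `|L| + 1))) a.
  by apply: nbhsx_ballx; rewrite divr_gt0.
near=> a.
have za : ball z 1 a by near: a; exact: nb1.
have [d1 d2] : ball z (e / (2 * (I * `|L| + 1))) a by near: a; exact: nb2.
have D0 : `|z.1 - a.1| + `|z.2 - a.2| <= e / (I * `|L| + 1).
  rewrite (_ : e / _ = e / (2 * (I * `|L| + 1)) + e / (2 * (I * `|L| + 1))).
    by rewrite lerD// ltW.
  by field; rewrite gt_eqF// ltr_wpDl ?mulr_ge0.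
rewrite /potential -intDB; [|exact: L1D_bump_moment..].
apply: (le_trans (norm_intD _)); first by apply: L1DB; exact: L1D_bump_moment.
apply: (@le_trans _ _ (intD (fun w => (`|L| * (e / (I * `|L| + 1))) * `|u w|))).
  apply: le_intD => [||w Dw].
  - by apply/L1D_norm/L1DB; exact: L1D_bump_moment.
  - exact/L1DZ/L1D_norm.
  rewrite -mulrBr normrM mulrC ler_wpM2r//.
  have [_ h] := H z a w (ballxx _ ltr01) za Dw; apply: le_trans h _.
  apply: (@le_trans _ _ (`|L| * (`|z.1 - a.1| + `|z.2 - a.2|))).
    by rewrite ler_wpM2r ?addr_ge0// ler_norm.
  by rewrite ler_wpM2l.
rewrite intDZ; last exact: L1D_norm.
rewrite -/I mulrAC mulrA ler_pdivrMr ?ltr_wpDl ?mulr_ge0//.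
by rewrite [leRHS]mulrDr mulr1 (mulrC `|L|) [leLHS]mulrC lerDl ltW.
Unshelve. all: by end_near. Qed.

Lemma globalC_lin k (a b : R) f g : globalC k f -> globalC k g ->
  globalC k (fun z => a * f z - b * g z).
Proof.
elim: k f g => [|k IH] f g /= [cf Hf] [cg Hg].
  split=> // z; apply: cvgB; apply: cvgM; [exact: cvg_cst|exact: cf|exact: cvg_cst|exact: cg].
split.
  by move=> z; apply: cvgB; apply: cvgM; [exact: cvg_cst|exact: cf|exact: cvg_cst|exact: cg].
case: Hf => f1 [f2 [df1 df2 Cf1 Cf2]]; case: Hg => g1 [g2 [dg1 dg2 Cg1 Cg2]].
exists (fun z => a * f1 z - b * g1 z), (fun z => a * f2 z - b * g2 z).
split; [..|exact: IH|exact: IH] => z.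
- exact: (is_deriveB (is_deriveZ a (df1 z)) (is_deriveZ b (dg1 z))).
- exact: (is_deriveB (is_deriveZ a (df2 z)) (is_deriveZ b (dg2 z))).
Qed.

Lemma globalC_potential k u i j n s : L1D u ->
  globalC k (potential u i j (k + n).+1 s).
Proof.
move=> u1; elim: k i j n => [|k IH] i j n /=.
  by split=> //; exact: continuous_potential.
split; first exact: continuous_potential.
eexists; eexists; split=> [z|z||].
- by rewrite addSn; apply: is_derive_potential1.
- by rewrite addSn; apply: is_derive_potential2.
- by apply: globalC_lin; [exact: IH|rewrite -addnS; exact: IH].
- by apply: globalC_lin; [exact: IH|rewrite -addnS; exact: IH].
Qed.

(** For P_n(w) = (s - |w - z|^2)_+^n the relation |w - z|^2 P_1 = s P_1 - P_2
    eliminates the second moments. *)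
Lemma laplacian_potential u s z : L1D u -> laplacian (potential u 0 0 3 s) z =
  12 * (2 * s * potential u 0 0 1 s z - 3 * potential u 0 0 2 s z).
Proof.
move=> u1; rewrite /laplacian.
have D1 : 'D_e1 (potential u 0 0 3 s) = (fun z => 6 * potential u 1 0 2 s z).
  apply/funext => a.
  by rewrite (derive_val (is_derive := is_derive_potential1 0 0 1 s a u1)); ring.
have D2 : 'D_e2 (potential u 0 0 3 s) = (fun z => 6 * potential u 0 1 2 s z).
  apply/funext => a.
  by rewrite (derive_val (is_derive := is_derive_potential2 0 0 1 s a u1)); ring.
apply: (etrans (congr2 +%R (congr1 (fun F => 'D_e1 F z) D1)
  (congr1 (fun F => 'D_e2 F z) D2))).
rewrite (derive_val (is_derive := is_deriveZ 6 (is_derive_potential1 1 0 0 s z u1))).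
rewrite (derive_val (is_derive := is_deriveZ 6 (is_derive_potential2 0 1 0 s z u1))).
have H : potential u 2 0 1 s z + potential u 0 2 1 s z =
    s * potential u 0 0 1 s z - 1 * potential u 0 0 2 s z.
  rewrite -intD_bump_moment_comb// /potential -intDD; [|exact: L1D_bump_moment..].
  apply: eq_intD => w _; rewrite /bump_moment !expr0 -[pospow 2 _]pospowS; ring.
rewrite /GRing.scale/=; move: H; move: (potential _ _ _ _ _ _) => a.
move: (potential _ 0 2 _ _ _) => b; move: (potential _ _ _ 1 _ _) => c.
by move: (potential _ _ _ _ _ _) => d H; lra.
Qed.

End potential.

(** * Green's identity *)

Section green.
Context {R : realType}.
Local Notation plane := (R * R)%type.
Local Notation mplane := (measurableTypeR R * measurableTypeR R)%type.
Local Notation lambda := (@lebesgue_measure R).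
Implicit Types (u v f g : plane -> R) (A : set plane) (z w : plane).

(** dA is Lebesgue measure divided by pi; passing to Lebesgue measure makes
    Fubini's theorem applicable. *)
Lemma ge0_integral_dA (f : mplane -> \bar R) : measurable_fun (disk : set mplane) f ->
  (forall z, 0 <= f z)%E -> (\int[dA]_(z in (disk : set mplane)) f z =
  (1 / pi)%:E * \int[(lambda \x lambda)%E]_(z in (disk : set mplane)) f z)%E.
Proof.
move=> mf f0; rewrite /dA.
rewrite ge0_integral_mscale.
- by [].
- exact: measurable_disk.
- by [].
- by [].
Qed.

Lemma L1D_lebesgue f : L1D f ->
  (lambda \x lambda)%E.-integrable (disk : set mplane) (EFin \o f).
Proof.
move=> /integrableP[mf fi]; apply/integrableP; split=> //; move: fi.
rewrite ge0_integral_dA//; last by apply: measurableT_comp.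
move: (integral _ _ _) => x; case: x => [r _||_]; rewrite ?ltry ?ltNyr//.
by rewrite gt0_muley// lte_fin divr_gt0// pi_gt0.
Qed.

Lemma intD_lebesgue f : L1D f -> intD f =
  (1 / pi) * fine (\int[(lambda \x lambda)%E]_z ((f \_ (disk : set mplane)) z)%:E)%E.
Proof.
move=> f1; have f1' := L1D_lebesgue f1.
have mf : measurable_fun (disk : set mplane) (EFin \o f) by case/integrableP : f1.
rewrite /intD /Rintegral.
rewrite (_ : (\int[dA]_(z in (disk : set mplane)) (f z)%:E)%E =
  ((1 / pi)%:E * (\int[(lambda \x lambda)%E]_(z in (disk : set mplane)) (f z)%:E))%E).
  rewrite fineM//; last exact: (integrable_fin_num measurable_disk f1').
  congr (_ * fine _); rewrite integral_mkcond; apply: eq_integral => z _.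
  by rewrite restrict_EFin.
have fp := integrable_pos_fin_num measurable_disk f1'.
have fn := integrable_neg_fin_num measurable_disk f1'.
apply: etrans (integralE _ _ _) _.
rewrite (ge0_integral_dA (measurable_funepos mf)) ?(ge0_integral_dA (measurable_funeneg mf))//.
rewrite -muleBr//; last exact: (fin_num_adde_defr _ fp).
by congr (_ * _)%E; rewrite -integralE.
Qed.

Lemma integrable_restrict_disk f : L1D f ->
  (lambda \x lambda)%E.-integrable setT (fun z => ((f \_ (disk : set mplane)) z)%:E).
Proof.
move=> /L1D_lebesgue/(integrable_mkcond _ measurable_disk).
by rewrite restrict_EFin.
Qed.

Lemma intD_fubini1 f : L1D f -> intD f = (1 / pi) *
  fine (\int[lambda]_y \int[lambda]_x ((f \_ (disk : set mplane)) (x, y))%:E)%E.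
Proof.
move=> f1; rewrite intD_lebesgue//.
by rewrite -(integral21_prod_meas1 (integrable_restrict_disk f1)).
Qed.

Lemma intD_fubini2 f : L1D f -> intD f = (1 / pi) *
  fine (\int[lambda]_x \int[lambda]_y ((f \_ (disk : set mplane)) (x, y))%:E)%E.
Proof.
move=> f1; rewrite intD_lebesgue//.
by rewrite -(integral12_prod_meas1 (integrable_restrict_disk f1)).
Qed.

Definition cbox z (a : R) : set plane :=
  [set w | `|w.1 - z.1| <= a /\ `|w.2 - z.2| <= a].

Lemma bump_moment_out i j n s z (a : R) w : 0 < a -> s <= a ^+ 2 ->
  a <= `|w.1 - z.1| \/ a <= `|w.2 - z.2| -> bump_moment i j n.+1 s z w = 0.
Proof.
move=> a0 sa H; rewrite /bump_moment pospow_le0 ?mulr0//.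
have sq (x : R) : a <= `|x| -> s <= x ^+ 2.
  move=> ax; apply: (le_trans sa); rewrite -[leRHS]real_normK ?num_real//.
  by rewrite lerXn2r ?nnegrE// ltW.
have q0 (x : R) : 0 <= x ^+ 2 by exact: sqr_ge0.
by case: H => /sq h; have := q0 (w.1 - z.1); have := q0 (w.2 - z.2); lra.
Qed.

Lemma bump_moment_out_cbox i j n s z (a : R) w : 0 < a -> s <= a ^+ 2 ->
  ~ cbox z a w -> bump_moment i j n.+1 s z w = 0.
Proof.
move=> a0 sa /not_andP H; apply: bump_moment_out a0 sa _.
by case: H => /negP; rewrite -ltNge => /ltW; [left|right].
Qed.

(** Exchanging the two arguments turns derivatives in w into derivatives in z. *)
Lemma bump_momentC i j n s z w :
  bump_moment i j n s z w = (- 1) ^+ (i + j) * bump_moment i j n s w z.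
Proof.
rewrite /bump_moment -(opprB z.1) -(opprB z.2) !sqrrN (exprNn _ i) (exprNn _ j) exprD; ring.
Qed.

Lemma continuous_pospow n : continuous (@pospow R n).
Proof.
move=> x.
suff H : (fun y : R => Num.max 0 y) y @[y --> x] --> Num.max 0 x.
  exact: (cvg_comp _ _ H (@exprn_continuous R n _)).
rewrite (funext maxr0E : (fun y : R => Num.max 0 y) = _) maxr0E.
apply: (@cvgMl _ _ (nbhs x) _ (fun y : R => y + `|y|)).
by apply: cvgD; [exact: cvg_id|exact: norm_continuous].
Qed.

Lemma continuous_bump_moment i j n s z : continuous (bump_moment i j n s z).
Proof.
move=> w.
have c1 : (fun w : plane => w.1 - z.1) x @[x --> w] --> w.1 - z.1.
  by apply: cvgB; [exact: cvg_fst|exact: cvg_cst].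
have c2 : (fun w : plane => w.2 - z.2) x @[x --> w] --> w.2 - z.2.
  by apply: cvgB; [exact: cvg_snd|exact: cvg_cst].
have X (h : plane -> R) (l : R) m : h x @[x --> w] --> l -> h x ^+ m @[x --> w] --> l ^+ m.
  move=> hl; exact: (cvg_comp _ _ hl (@exprn_continuous R m l)).
apply: cvgM; first by apply: cvgM; exact: X.
suff H : (fun w : plane => s - (w.1 - z.1) ^+ 2 - (w.2 - z.2) ^+ 2) x @[x --> w] -->
    s - (w.1 - z.1) ^+ 2 - (w.2 - z.2) ^+ 2.
  exact: (cvg_comp _ _ H (@continuous_pospow n _)).
by apply: cvgB; [apply: cvgB; [exact: cvg_cst|exact: X]|exact: X].
Qed.

Lemma within_continuous_itv (f : R -> R) (a b : R) :
  (forall x, a <= x <= b -> {for x, continuous f}) -> {within `[a, b], continuous f}.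
Proof.
move=> H; apply: continuous_in_subspaceT => x; rewrite inE/= in_itv/=; exact: H.
Qed.

Lemma is_derive_continuous (f : R -> R) (x l : R) : is_derive x 1 f l -> {for x, continuous f}.
Proof. by move=> df; apply/differentiable_continuous/derivable1_diffP/ex_derive. Qed.

Lemma integral_derive_eq0 (F f : R -> R) (a b : R) : a < b ->
  (forall x, a <= x <= b -> is_derive x 1 F (f x)) ->
  (forall x, a <= x <= b -> {for x, continuous f}) ->
  F a = 0 -> F b = 0 -> (\int[lambda]_(x in `[a, b]) (f x)%:E = 0)%E.
Proof.
move=> ab dF cf Fa Fb; rewrite (continuous_FTC2 (F := F))//.
- by rewrite Fa Fb sube0.
- exact: within_continuous_itv.
- have c x : a <= x <= b -> {for x, continuous F} by move=> /dF/is_derive_continuous.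
  split.
  + move=> x; rewrite in_itv/= => /andP[ax xb].
    by apply: (@ex_derive _ _ _ _ _ _ (f x)); apply: dF; rewrite !ltW.
  + by apply: cvg_at_right_filter; apply: c; rewrite lexx ltW.
  + by apply: cvg_at_left_filter; apply: c; rewrite lexx ltW.
- move=> x; rewrite in_itv/= => /andP[ax xb]; rewrite derive1E.
  by have dFx : is_derive x 1 F (f x) by [apply: dF; rewrite !ltW]; rewrite derive_val.
Qed.

(** The pure second partial derivatives in w of the truncated power of exponent
    n + 3. *)
Definition bump_d11 n s z w : R :=
  2 * n.+3%:R * (2 * n.+2%:R * bump_moment 2 0 n.+1 s z w - bump_moment 0 0 n.+2 s z w).
Definition bump_d22 n s z w : R :=
  2 * n.+3%:R * (2 * n.+2%:R * bump_moment 0 2 n.+1 s z w - bump_moment 0 0 n.+2 s z w).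

Lemma bump_d11_d22 n s z w : bump_d11 n s z w + bump_d22 n s z w =
  4 * n.+3%:R * (n.+2%:R * s * bump_moment 0 0 n.+1 s z w - n.+3%:R * bump_moment 0 0 n.+2 s z w).
Proof.
rewrite /bump_d11 /bump_d22 /bump_moment -[pospow n.+2 _]pospowS !expr0; ring.
Qed.

(** The integrands v P_xx - v_xx P and v P_yy - v_yy P, each of which is an exact
    derivative along the corresponding coordinate lines. *)
Definition green1 v n s z w :=
  v w * bump_d11 n s z w - 'D_e1 ('D_e1 v) w * bump_moment 0 0 n.+3 s z w.
Definition green2 v n s z w :=
  v w * bump_d22 n s z w - 'D_e2 ('D_e2 v) w * bump_moment 0 0 n.+3 s z w.

Lemma continuous_d11 n s z : continuous (bump_d11 n s z).
Proof.
move=> w; apply: cvgM; first exact: cvg_cst.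
by apply: cvgB; [apply: cvgM; [exact: cvg_cst|]|]; exact: continuous_bump_moment.
Qed.

Lemma continuous_d22 n s z : continuous (bump_d22 n s z).
Proof.
move=> w; apply: cvgM; first exact: cvg_cst.
by apply: cvgB; [apply: cvgM; [exact: cvg_cst|]|]; exact: continuous_bump_moment.
Qed.

Lemma continuous_green1 v n s z : classC 2 v -> {in disk, continuous (green1 v n s z)}.
Proof.
move=> Cv w wD; have C2 := classC_derive (or_introl erefl) (classC_derive (or_introl erefl) Cv).
apply: cvgB; apply: cvgM; [exact: classC_continuous Cv w wD|exact: continuous_d11
 |exact: classC_continuous C2 w wD|exact: continuous_bump_moment].
Qed.

Lemma continuous_green2 v n s z : classC 2 v -> {in disk, continuous (green2 v n s z)}.
Proof.
move=> Cv w wD; have C2 := classC_derive (or_intror erefl) (classC_derive (or_intror erefl) Cv).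
apply: cvgB; apply: cvgM; [exact: classC_continuous Cv w wD|exact: continuous_d22
 |exact: classC_continuous C2 w wD|exact: continuous_bump_moment].
Qed.

Lemma compact_cbox z a : compact (cbox z a).
Proof.
have -> : cbox z a = `[z.1 - a, z.1 + a]%classic `*` `[z.2 - a, z.2 + a]%classic.
  by apply/seteqP; split=> w /=; rewrite /cbox/= !ler_distl !in_itv/=.
by apply: compact_setX; exact: segment_compact.
Qed.

(** Continuity on the open disk alone gives no bound; compactness of the box does. *)
Lemma L1D_box_supported f z a : cbox z a `<=` disk -> {in disk, continuous f} ->
  (forall w, ~ cbox z a w -> f w = 0) -> L1D f.
Proof.
move=> boxD cf f0.
have : compact (f @` cbox z a).
  apply: continuous_compact; last exact: compact_cbox.
  by apply: continuous_in_subspaceT => w /set_mem/boxD Dw; apply: cf; rewrite inE.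
move=> /compact_bounded[M [_ HM]].
apply: (@L1D_bounded _ (`|M| + 1)); first exact: continuous_disk_measurable.
move=> w _; have [bw|bw] := pselect (cbox z a w); last by rewrite f0// normr0 addr_ge0.
apply: (HM (`|M| + 1)); last by exists w.
by rewrite (le_lt_trans (ler_norm _))// ltrDl.
Qed.

Lemma green1_out v n s z (a : R) w : 0 < a -> s <= a ^+ 2 -> ~ cbox z a w ->
  green1 v n s z w = 0.
Proof.
move=> a0 sa nb; rewrite /green1 /bump_d11.
by rewrite !(bump_moment_out_cbox _ _ _ a0 sa nb) !(mulr0, subr0).
Qed.

Lemma green2_out v n s z (a : R) w : 0 < a -> s <= a ^+ 2 -> ~ cbox z a w ->
  green2 v n s z w = 0.
Proof.
move=> a0 sa nb; rewrite /green2 /bump_d22.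
by rewrite !(bump_moment_out_cbox _ _ _ a0 sa nb) !(mulr0, subr0).
Qed.

Lemma is_derive_bump_moment_w1 n s z (x y : R) :
  is_derive x 1 (fun x => bump_moment 0 0 n.+3 s z (x, y))
    (- (2 * n.+3%:R * bump_moment 1 0 n.+2 s z (x, y))).
Proof.
rewrite (_ : (fun x => _) = (fun x => bump_moment 0 0 n.+3 s (x, y) z)); last first.
  by apply/funext => t; rewrite bump_momentC expr0 mul1r.
apply: (is_derive_eq (is_derive_bump_moment1 0 0 n.+1 s x y z)).
by rewrite (bump_momentC 1 0 n.+2 s _ z) expr1; ring.
Qed.

Lemma is_derive_bump_moment_w11 n s z (x y : R) :
  is_derive x 1 (fun x => - (2 * n.+3%:R * bump_moment 1 0 n.+2 s z (x, y)))
    (bump_d11 n s z (x, y)).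
Proof.
rewrite (_ : (fun x => _) = (fun x => 2 * n.+3%:R * bump_moment 1 0 n.+2 s (x, y) z)); last first.
  by apply/funext => t; rewrite bump_momentC expr1; ring.
apply: (is_derive_eq (is_deriveZ (2 * n.+3%:R) (is_derive_bump_moment1 1 0 n s x y z))).
by rewrite /bump_d11 (bump_momentC 2 0 _ _ _ z) (bump_momentC 0 0 _ _ _ z) /GRing.scale/=; ring.
Qed.

Lemma is_derive_bump_moment_w2 n s z (x y : R) :
  is_derive y 1 (fun y => bump_moment 0 0 n.+3 s z (x, y))
    (- (2 * n.+3%:R * bump_moment 0 1 n.+2 s z (x, y))).
Proof.
rewrite (_ : (fun x => _) = (fun y => bump_moment 0 0 n.+3 s (x, y) z)); last first.
  by apply/funext => t; rewrite bump_momentC expr0 mul1r.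
apply: (is_derive_eq (is_derive_bump_moment2 0 0 n.+1 s y x z)).
by rewrite (bump_momentC 0 1 n.+2 s _ z) expr1; ring.
Qed.

Lemma is_derive_bump_moment_w22 n s z (x y : R) :
  is_derive y 1 (fun y => - (2 * n.+3%:R * bump_moment 0 1 n.+2 s z (x, y)))
    (bump_d22 n s z (x, y)).
Proof.
rewrite (_ : (fun x => _) = (fun y => 2 * n.+3%:R * bump_moment 0 1 n.+2 s (x, y) z)); last first.
  by apply/funext => t; rewrite bump_momentC expr1; ring.
apply: (is_derive_eq (is_deriveZ (2 * n.+3%:R) (is_derive_bump_moment2 0 1 n s y x z))).
by rewrite /bump_d22 (bump_momentC 0 2 _ _ _ z) (bump_momentC 0 0 _ _ _ z) /GRing.scale/=; ring.
Qed.

Lemma slice1_continuous v (x y : R) : {for (x, y), continuous v} ->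
  {for x, continuous (fun t => v (t, y))}.
Proof.
move=> cv; suff H : (fun t : R => (t, y)) t @[t --> x] --> (x, y) by exact: (cvg_comp _ _ H cv).
exact: (cvg_pair (@cvg_id _ (nbhs x)) (@cvg_cst _ y _ (nbhs x) _)).
Qed.

Lemma slice2_continuous v (x y : R) : {for (x, y), continuous v} ->
  {for y, continuous (fun t => v (x, t))}.
Proof.
move=> cv; suff H : (fun t : R => (x, t)) t @[t --> y] --> (x, y) by exact: (cvg_comp _ _ H cv).
exact: (cvg_pair (@cvg_cst _ x _ (nbhs y) _) (@cvg_id _ (nbhs y))).
Qed.

Lemma disk_derive_slice1 v (x y : R) : classC 1 v -> disk (x, y) ->
  is_derive x 1 (fun t => v (t, y)) ('D_e1 v (x, y)).
Proof.
move=> Cv D; apply/(is_derive_slice1 v (x, y)); apply: derivableP.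
by apply: (classC_derivable _ Cv); [left|rewrite inE].
Qed.

Lemma disk_derive_slice2 v (x y : R) : classC 1 v -> disk (x, y) ->
  is_derive y 1 (fun t => v (x, t)) ('D_e2 v (x, y)).
Proof.
move=> Cv D; apply/(is_derive_slice2 v (x, y)); apply: derivableP.
by apply: (classC_derivable _ Cv); [right|rewrite inE].
Qed.

Lemma classCW k v : classC k.+1 v -> classC k v.
Proof.
elim: k v => [|k IH] v [cv dv]; first by split.
by split=> // e eE; have [d1 C1] := dv e eE; split=> //; exact: IH.
Qed.

(** On the line of height y the integrand is the derivative of v P_x - v_x P,
    which vanishes at both ends of the box since P and P_x do. *)
Lemma green1_slice v n s z (a y : R) : classC 2 v -> 0 < a -> s <= a ^+ 2 ->
  cbox z a `<=` disk ->
  (\int[lambda]_x ((green1 v n s z \_ (disk : set mplane)) (x, y))%:E = 0)%E.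
Proof.
move=> Cv a0 sa boxD.
have [yb|yb] := leP `|y - z.2| a; last first.
  apply: integral0_eq => x _; rewrite patchE; case: ifPn => // _.
  by rewrite (green1_out _ _ a0 sa)// => -[_]; rewrite /= leNgt yb.
transitivity (\int[lambda]_(x in `[(z.1 - a)%R, (z.1 + a)%R]) (green1 v n s z (x, y))%:E)%E.
  rewrite [RHS]integral_mkcond; apply: eq_integral => x _; rewrite !patchE.
  case: ifPn => [xy|nxy].
    case: ifPn => // nx; rewrite (green1_out _ _ a0 sa)// => -[/= xb _].
    by move: nx; rewrite notin_setE /= in_itv/= -ler_distl.
  case: ifPn => // /set_mem /=; rewrite in_itv/= -ler_distl => xb.
  by move: nxy; rewrite notin_setE => -[]; apply: boxD.
have Dx x : z.1 - a <= x <= z.1 + a -> disk (x, y).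
  by rewrite -ler_distl => xb; exact: boxD.
have C1 := classC_derive (or_introl erefl) Cv.
apply: (integral_derive_eq0 (F := fun x =>
  v (x, y) * - (2 * n.+3%:R * bump_moment 1 0 n.+2 s z (x, y)) -
  'D_e1 v (x, y) * bump_moment 0 0 n.+3 s z (x, y))).
- by rewrite ltrD2l gtrN.
- move=> x /Dx xD.
  have d1 := disk_derive_slice1 (classCW Cv) xD.
  have d2 := disk_derive_slice1 C1 xD.
  apply: (is_derive_eq (is_deriveB (is_deriveM d1 (is_derive_bump_moment_w11 n s z x y))
    (is_deriveM d2 (is_derive_bump_moment_w1 n s z x y)))).
  rewrite /green1 /GRing.scale/=; ring.
- move=> x /Dx xD; apply: slice1_continuous; apply: continuous_green1 => //.
  by rewrite inE.
- have out i j m : bump_moment i j m.+1 s z (z.1 - a, y) = 0.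
    apply: (bump_moment_out _ _ _ a0 sa); left.
    by rewrite /= addrAC subrr add0r normrN (gtr0_norm a0).
  by rewrite !out !(mulr0, oppr0, subr0).
- have out i j m : bump_moment i j m.+1 s z (z.1 + a, y) = 0.
    apply: (bump_moment_out _ _ _ a0 sa); left.
    by rewrite /= addrAC subrr add0r (gtr0_norm a0).
  by rewrite !out !(mulr0, oppr0, subr0).
Qed.

Lemma green2_slice v n s z (a x : R) : classC 2 v -> 0 < a -> s <= a ^+ 2 ->
  cbox z a `<=` disk ->
  (\int[lambda]_y ((green2 v n s z \_ (disk : set mplane)) (x, y))%:E = 0)%E.
Proof.
move=> Cv a0 sa boxD.
have [yb|yb] := leP `|x - z.1| a; last first.
  apply: integral0_eq => y _; rewrite patchE; case: ifPn => // _.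
  by rewrite (green2_out _ _ a0 sa)// => -[]; rewrite /= leNgt yb.
transitivity (\int[lambda]_(y in `[(z.2 - a)%R, (z.2 + a)%R]) (green2 v n s z (x, y))%:E)%E.
  rewrite [RHS]integral_mkcond; apply: eq_integral => y _; rewrite !patchE.
  case: ifPn => [xy|nxy].
    case: ifPn => // nx; rewrite (green2_out _ _ a0 sa)// => -[/= _ xb].
    by move: nx; rewrite notin_setE /= in_itv/= -ler_distl.
  case: ifPn => // /set_mem /=; rewrite in_itv/= -ler_distl => xb.
  by move: nxy; rewrite notin_setE => -[]; apply: boxD.
have Dx y : z.2 - a <= y <= z.2 + a -> disk (x, y).
  by rewrite -ler_distl => xb; exact: boxD.
have C1 := classC_derive (or_intror erefl) Cv.
apply: (integral_derive_eq0 (F := fun y =>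
  v (x, y) * - (2 * n.+3%:R * bump_moment 0 1 n.+2 s z (x, y)) -
  'D_e2 v (x, y) * bump_moment 0 0 n.+3 s z (x, y))).
- by rewrite ltrD2l gtrN.
- move=> y /Dx xD.
  have d1 := disk_derive_slice2 (classCW Cv) xD.
  have d2 := disk_derive_slice2 C1 xD.
  apply: (is_derive_eq (is_deriveB (is_deriveM d1 (is_derive_bump_moment_w22 n s z x y))
    (is_deriveM d2 (is_derive_bump_moment_w2 n s z x y)))).
  rewrite /green2 /GRing.scale/=; ring.
- move=> y /Dx xD; apply: slice2_continuous; apply: continuous_green2 => //.
  by rewrite inE.
- have out i j m : bump_moment i j m.+1 s z (x, z.2 - a) = 0.
    apply: (bump_moment_out _ _ _ a0 sa); right.
    by rewrite /= addrAC subrr add0r normrN (gtr0_norm a0).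
  by rewrite !out !(mulr0, oppr0, subr0).
- have out i j m : bump_moment i j m.+1 s z (x, z.2 + a) = 0.
    apply: (bump_moment_out _ _ _ a0 sa); right.
    by rewrite /= addrAC subrr add0r (gtr0_norm a0).
  by rewrite !out !(mulr0, oppr0, subr0).
Qed.

(** For P = (s - |w - z|^2)_+^(n+3), \Delta P is the multiple by 4 (n+3) of
    (n+2) s (s - |w - z|^2)_+^(n+1) - (n+3) (s - |w - z|^2)_+^(n+2), and the integral
    of v \Delta P equals that of P \Delta v, which is 0. *)
Lemma green_identity v n s z (a : R) : L1D v -> real_harmonicD v -> 0 < a ->
  s <= a ^+ 2 -> cbox z a `<=` disk ->
  n.+2%:R * s * potential v 0 0 n.+1 s z = n.+3%:R * potential v 0 0 n.+2 s z.
Proof.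
move=> v1 [Cv Lv] a0 sa boxD.
have G1 : L1D (green1 v n s z).
  apply: (L1D_box_supported (f := green1 v n s z) boxD) => [|w]; first exact: continuous_green1.
  exact: green1_out.
have G2 : L1D (green2 v n s z).
  apply: (L1D_box_supported (f := green2 v n s z) boxD) => [|w]; first exact: continuous_green2.
  exact: green2_out.
have I1 : intD (green1 v n s z) = 0.
  rewrite intD_fubini1// (eq_integral (cst 0%E)) ?integral0 ?mulr0// => y _.
  exact: (green1_slice _ _ Cv a0 sa boxD).
have I2 : intD (green2 v n s z) = 0.
  rewrite intD_fubini2// (eq_integral (cst 0%E)) ?integral0 ?mulr0// => y _.
  exact: (green2_slice _ _ Cv a0 sa boxD).
have : intD (fun w => green1 v n s z w + green2 v n s z w) = 0.
  exact: (etrans (intDD G1 G2) (etrans (congr2 +%R I1 I2) (addr0 0))).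
rewrite (@eq_intD _ _ (fun w => (4 * n.+3%:R) * (v w * (n.+2%:R * s * bump_moment 0 0 n.+1 s z w -
    n.+3%:R * bump_moment 0 0 n.+2 s z w)))); last first.
  move=> w Dw; have := Lv w (mem_set Dw); rewrite /laplacian.
  rewrite /green1 /green2; move: ('D_e1 ('D_e1 v) w) => p; move: ('D_e2 _ w) => q lw.
  rewrite (_ : _ + _ = v w * (bump_d11 n s z w + bump_d22 n s z w) -
   (p + q) * bump_moment 0 0 n.+3 s z w); last by ring.
  rewrite lw bump_d11_d22; ring.
rewrite intDZ; last first.
  have := L1DB (L1DZ (n.+2%:R * s) (L1D_bump_moment 0 0 n.+1 s z v1))
    (L1DZ n.+3%:R (L1D_bump_moment 0 0 n.+2 s z v1)).
  by apply: eq_L1D => w _; ring.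
rewrite intD_bump_moment_comb// => /eqP.
by rewrite mulf_eq0 mulf_eq0 !pnatr_eq0 /= subr_eq0 => /eqP.
Qed.

End green.

(** * The reproducing formula *)

Section reproducing.
Context {R : realType}.
Local Notation plane := (R * R)%type.
Local Notation mplane := (measurableTypeR R * measurableTypeR R)%type.
Local Notation lambda := (@lebesgue_measure R).
Implicit Types (u v f g : plane -> R) (A : set plane) (z w : plane).

Lemma integral_shift (f : R -> \bar R) (c : R) : measurable_fun setT f ->
  (forall x, 0 <= f x)%E -> (\int[lambda]_x f (x - c)%R = \int[lambda]_x f x)%E.
Proof.
move=> mf f0; pose phi := (fun x : measurableTypeR R => x - c : measurableTypeR R).
have mphi : measurable_fun setT phi by apply: measurable_funB.
have := @ge0_integral_pushforward _ _ _ _ R phi mphi lambda setT f measurableT mf (fun x _ => f0 x).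
rewrite preimage_setT => <-; apply: eq_measure_integral => A mA _.
apply/esym; apply: (@lebesgue_measure_unique R (pushforward lambda phi)) => //.
move=> _ [[x y] _ <-]; transitivity (lambda (phi @^-1` `]x, y])); last by [].
have -> : phi @^-1` `]x, y] = `]x + c, y + c]%classic.
  by apply/seteqP; split => t /=; rewrite !in_itv/= /phi ltrBrDr lerBlDr.
by rewrite !lebesgue_measure_itv/= !lte_fin ltrD2r -!EFinD opprD addrACA subrr addr0.
Qed.

(** With G(s) the integral, differentiation gives G' = 3 G_2 where G_2 is the
    integral with exponent 2, and Green's identity gives 3 s G_2 = 4 G; so
    s G' = 4 G. *)
Lemma power_law u z (a s t : R) : L1D u -> real_harmonicD u -> 0 < a ->
  cbox z a `<=` disk -> 0 < s < a ^+ 2 -> 0 < t < a ^+ 2 ->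
  potential u 0 0 3 s z / s ^+ 4 = potential u 0 0 3 t z / t ^+ 4.
Proof.
move=> u1 hu a0 boxD.
wlog st : s t / s <= t.
  by move=> H hs ht; have [/H ->|/ltW/H ->] := leP s t.
move=> /andP[s0 sa] /andP[t0 ta].
have D x : 0 < x < a ^+ 2 ->
    is_derive x 1 (fun x => potential u 0 0 3 x z * (x ^+ 4)^-1) 0.
  move=> /andP[x0 xa].
  have xn0 : x ^+ 4 != 0 by rewrite expf_neq0// gt_eqF.
  have G := @green_identity R u 1 x z a u1 hu a0 (ltW xa) boxD.
  have d1 := is_derive_potential_s 0 0 1 z x u1.
  have d2 := is_deriveV (f := fun y : R => y ^+ 4) xn0 (is_derive_exprn 4 x).
  apply: (is_derive_eq (is_deriveM d1 d2)).
  move: G d1 {d2}; move: (potential u 0 0 2 x z) (potential u 0 0 3 x z) => p q G _.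
  rewrite /GRing.scale/=; have -> : q = 3 * x * p / 4 by rewrite G; field.
  by field; rewrite gt_eqF.
have [||c _] := @MVT_segment R (fun x => potential u 0 0 3 x z * (x ^+ 4)^-1) (cst 0) s t st.
- move=> x; rewrite in_itv/= => /andP[sx xt]; apply: D.
  by rewrite (lt_trans s0 sx) (lt_trans xt ta).
- apply: within_continuous_itv => x /andP[sx xt].
  by apply: is_derive_continuous (D x _); rewrite (lt_le_trans s0 sx) (le_lt_trans xt ta).
by rewrite mul0r => /eqP; rewrite subr_eq0 => /eqP.
Qed.

Lemma bump_moment_ge0 n s z w : 0 <= bump_moment 0 0 n s z w.
Proof. by rewrite /bump_moment !mul1r pospow_ge0. Qed.

Lemma potential_addZ c u v i j n s z : L1D u -> L1D v ->
  potential (fun w => u w + c * v w) i j n s z =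
  potential u i j n s z + c * potential v i j n s z.
Proof.
move=> u1 v1; rewrite /potential -intDZ; last exact: L1D_bump_moment.
rewrite -intDD; [|exact: L1D_bump_moment|exact/L1DZ/L1D_bump_moment].
by apply: eq_intD => w _; ring.
Qed.

(** Subtracting the constant u z, one may assume u z = 0.  On a small box u is at
    most e in absolute value, so the integral of u is at most e times that of 1 for
    small s, hence for all s since both are proportional to s^4. *)
Lemma reproducing u z (a s : R) : L1D u -> real_harmonicD u -> 0 < a ->
  cbox z a `<=` disk -> 0 < s < a ^+ 2 ->
  potential u 0 0 3 s z = u z * potential (cst 1) 0 0 3 s z.
Proof.
move=> u1 hu a0 boxD sa.
pose v w := u w + (- u z) * (cst 1 : plane -> R) w.
have c1 : L1D (cst 1 : plane -> R) by exact: L1D_cst.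
have v1 : L1D v by apply: L1DD => //; exact: L1DZ.
have hv : real_harmonicD v by exact: (harmonic_addZ (- u z) hu (harmonic_cst 1)).
have vz : v z = 0 by rewrite /v /= mulr1 subrr.
have zD : disk z by apply: boxD; rewrite /cbox/= !subrr normr0 ltW.
suff : potential v 0 0 3 s z = 0.
  by rewrite potential_addZ// mulNr => /eqP; rewrite subr_eq0 => /eqP.
have cv : v w @[w --> z] --> v z.
  by case: hv => Cv _; apply: (classC_continuous Cv); rewrite inE.
have P0 : 0 <= potential (cst 1) 0 0 3 s z.
  by apply: intD_ge0 => w _; rewrite mul1r bump_moment_ge0.
have bound e : 0 < e -> `|potential v 0 0 3 s z| <= e * potential (cst 1) 0 0 3 s z.
  move=> e0.
  have /nbhs_ballP[d /= d0 dv] : \forall w \near z, `|v w| <= e.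
    by move/cvgrPdist_le : cv => /(_ _ e0); rewrite vz; apply: filterS => w; rewrite sub0r normrN.
  pose b := Num.min (d / 2) (a / 2).
  have b0 : 0 < b by rewrite lt_min !divr_gt0.
  have bd : b < d by rewrite gt_min ltr_pdivrMr// ltr_pMr// ltr1n.
  have ba : b < a by rewrite gt_min orbC ltr_pdivrMr// ltr_pMr// ltr1n.
  have b2 : 0 < b ^+ 2 < a ^+ 2 by rewrite exprn_gt0//= ltrXn2r// ltW.
  have Pv := power_law v1 hv a0 boxD sa b2.
  have P1 := power_law c1 (harmonic_cst 1) a0 boxD sa b2.
  have s0 : 0 < s by case/andP : sa.
  have s4 : 0 < s ^+ 4 by rewrite exprn_gt0.
  have b4 : 0 < (b ^+ 2) ^+ 4 by rewrite !exprn_gt0.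
  suff H : `|potential v 0 0 3 (b ^+ 2) z| <= e * potential (cst 1) 0 0 3 (b ^+ 2) z.
    have scale (x y : R) : x / s ^+ 4 = y / (b ^+ 2) ^+ 4 -> x = y * (s ^+ 4 / (b ^+ 2) ^+ 4).
      by move=> xy; rewrite mulrCA -xy mulrCA divff ?mulr1// gt_eqF.
    rewrite (scale _ _ Pv) (scale _ _ P1); have r0 := divr_gt0 s4 b4.
    move: (_ / _) r0 => r r0.
    by rewrite normrM (gtr0_norm r0) [leRHS]mulrA ler_wpM2r// ltW.
  rewrite -intDZ; last exact: L1D_bump_moment.
  apply: (le_trans (norm_intD (L1D_bump_moment _ _ _ _ _ v1))); apply: le_intD.
  - exact/L1D_norm/L1D_bump_moment.
  - exact/L1DZ/L1D_bump_moment.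
  move=> w _; rewrite normrM (ger0_norm (bump_moment_ge0 _ _ _ _)) mul1r.
  have [bw|nb] := pselect (cbox z b w); last first.
    by rewrite (bump_moment_out_cbox _ _ _ b0 (lexx _) nb) !mulr0.
  rewrite ler_wpM2r ?bump_moment_ge0//; apply: dv; apply/ball_planeE.
  by case: bw => w1 w2; rewrite !(distrC z.1) !(distrC z.2) !(le_lt_trans _ bd).
apply/eqP; rewrite -normr_le0; apply/ler_addgt0Pr => e e0; rewrite add0r.
have p1 : 0 < potential (cst 1) 0 0 3 s z + 1 by rewrite ltr_wpDl.
apply: (le_trans (bound (e / (potential (cst 1) 0 0 3 s z + 1)) _)); first by rewrite divr_gt0.
by rewrite mulrAC ler_pdivrMr// ler_wpM2l ?ltW// ltrDl.
Qed.

(** The constant of the reproducing formula, written with the kernel centred at the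
    origin and integrated over the whole plane so that it visibly does not depend on
    the centre. *)
Definition bump_mass (s : R) : R := (1 / pi) *
  fine (\int[lambda]_y \int[lambda]_x (bump_moment 0 0 3 s (0, 0) (x, y))%:E)%E.

Lemma measurable_bump_momentT s :
  measurable_fun setT (fun w : mplane => (bump_moment 0 0 3 s (0, 0) w)%:E).
Proof.
apply/measurable_EFinP; rewrite /bump_moment; under eq_fun do rewrite !mul1r.
apply: measurable_funX; apply: measurable_maxr => //.
apply: measurable_funB; last first.
  by apply: measurable_funX; apply: measurable_funB => //; exact: measurable_coord2.
apply: measurable_funB => //; apply: measurable_funX.
by apply: measurable_funB => //; exact: measurable_coord1.
Qed.

(** The kernel vanishes outside the box, so the integral over the disk is one over
    the plane, and translation invariance moves the centre to the origin. *)
Lemma potential_cst1 z (a s : R) : 0 < a -> cbox z a `<=` disk -> s <= a ^+ 2 ->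
  potential (cst 1) 0 0 3 s z = bump_mass s.
Proof.
move=> a0 boxD sa; rewrite /potential.
have c1 : L1D (cst 1 : plane -> R) by exact: L1D_cst.
rewrite intD_fubini1; last exact: L1D_bump_moment.
rewrite /bump_mass; congr (_ * fine _).
pose g (y : R) := (\int[lambda]_x (bump_moment 0 0 3 s (0, 0) (x, y))%:E)%E.
have mg : measurable_fun setT g.
  apply: (measurable_fun_fubini_tonelli_G (fun w : mplane => (bump_moment 0 0 3 s (0, 0) w)%:E)).
    exact: measurable_bump_momentT.
  by move=> w; rewrite lee_fin bump_moment_ge0.
have g0 y : (0 <= g y)%E by apply: integral_ge0 => x _; rewrite lee_fin bump_moment_ge0.
rewrite -[RHS](integral_shift z.2 mg g0); apply: eq_integral => y _; rewrite /g.
pose h (x : R) := (bump_moment 0 0 3 s (0, 0) (x, y - z.2))%:E.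
have mh : measurable_fun setT h.
  exact: (measurable_fun_pair1 (y - z.2) (measurable_bump_momentT s)).
have h0 x : (0 <= h x)%E by rewrite lee_fin bump_moment_ge0.
rewrite -[RHS](integral_shift z.1 mh h0); apply: eq_integral => x _; rewrite /h.
rewrite patchE; case: ifPn => [_|nD].
  by rewrite mul1r /bump_moment /= !subr0.
have nb : ~ cbox z a (x, y) by move/boxD/mem_set; rewrite (negbTE nD).
have := bump_moment_out_cbox 0 0 2 a0 sa nb.
by rewrite /bump_moment /= !subr0 => ->.
Qed.

(** On the box of half-side a / 4 the base s - |w - z|^2 is at least s / 2. *)
Lemma bump_mass_gt0 z (a : R) : 0 < a -> cbox z a `<=` disk ->
  0 < bump_mass ((a / 2) ^+ 2).
Proof.
move=> a0 boxD; set s := (a / 2) ^+ 2.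
have sa : s <= a ^+ 2 by rewrite /s; nra.
rewrite -(potential_cst1 a0 boxD sa).
pose b := a / 4.
pose B : set mplane := `[z.1 - b, z.1 + b]%classic `*` `[z.2 - b, z.2 + b]%classic.
have b0 : 0 < b by rewrite divr_gt0.
have BE w : B w -> `|w.1 - z.1| <= b /\ `|w.2 - z.2| <= b.
  by rewrite /B /= !in_itv/= -!ler_distl.
have mB : measurable B by apply: measurableX; exact: measurable_itv.
have BD : B `<=` disk.
  move=> w /BE[w1 w2]; apply: boxD; split; [apply: le_trans w1 _|apply: le_trans w2 _];
  rewrite /b; lra.
have mI : measurable_fun (disk : set mplane) (\1_B : mplane -> R) by exact: measurable_indic.
have I1 : L1D (\1_B : plane -> R).
  apply: (L1D_bounded mI (M := 1)) => w _.
  by rewrite indicE; case: (_ \in _); rewrite ?normr1 ?normr0.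
have c1 : L1D (cst 1 : plane -> R) by exact: L1D_cst.
apply: (@lt_le_trans _ _ ((s / 2) ^+ 3 * intD (\1_B : plane -> R))).
  have s0 : 0 < s by rewrite exprn_gt0// divr_gt0.
  rewrite mulr_gt0 ?exprn_gt0 ?divr_gt0//.
  rewrite /intD /Rintegral integral_indic//; last exact: measurable_disk.
  rewrite (setIidl BD) /dA /= /mscale /= /B product_measure1E; [|exact: measurable_itv..].
  rewrite /= !lebesgue_measure_itv/= !lte_fin !ltrD2l !gtrN// -!EFinB -!EFinM /=.
  by rewrite mulr_gt0 ?divr_gt0 ?pi_gt0// mulr_gt0//; lra.
rewrite -intDZ//; apply: le_intD; [exact: L1DZ|exact: L1D_bump_moment|].
move=> w _; rewrite mul1r indicE; case: (boolP (w \in B)) => [/set_mem/BE[w1 w2]|_]; last first.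
  by rewrite mulr0 bump_moment_ge0.
have sq (x : R) : `|x| <= b -> x ^+ 2 <= s / 4.
  move=> xb; rewrite -[leLHS]real_normK ?num_real//.
  rewrite (_ : s / 4 = b ^+ 2); last by rewrite /s /b; field.
  by rewrite lerXn2r// nnegrE ltW.
have s0 : 0 < s by rewrite exprn_gt0// divr_gt0.
have q1 := sq _ w1; have q2 := sq _ w2.
have qs : s / 2 <= s - (w.1 - z.1) ^+ 2 - (w.2 - z.2) ^+ 2 by lra.
rewrite mulr1 /bump_moment !mul1r pospow_pos; last by apply: le_trans qs; rewrite ltW ?divr_gt0.
rewrite lerXn2r// nnegrE; last apply: le_trans qs; by rewrite ltW ?divr_gt0.
Qed.

(** One radius and one constant serve a whole neighbourhood of z0, so the formula
    can be differentiated in z. *)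
Lemma local_reproducing z0 : disk z0 -> exists a s c : R,
  [/\ 0 < a, 0 < c & forall z, ball z0 a z ->
    disk z /\ forall u, L1D u -> real_harmonicD u ->
    potential u 0 0 3 s z = c * u z /\
    2 * s * potential u 0 0 1 s z = 3 * potential u 0 0 2 s z].
Proof.
move=> /near_disk /nbhs_ballP[e /= e0 eD].
(* Boxes of half-side e / 4 around points of the ball of radius e / 2 stay in
   the ball of radius e. *)
pose a := e / 4.
have a0 : 0 < a by rewrite divr_gt0.
have boxD z : ball z0 (e / 2) z -> cbox z a `<=` disk.
  move=> [z1 z2] w [w1 w2]; apply: eD; apply/ball_planeE.
  move: z1 z2; rewrite /ball/= => z1 z2; split.
    rewrite (le_lt_trans (ler_distD z.1 _ _))// (distrC z.1).
    by rewrite (lt_le_trans (ltr_leD z1 w1))// /a; lra.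
  rewrite (le_lt_trans (ler_distD z.2 _ _))// (distrC z.2).
  by rewrite (lt_le_trans (ltr_leD z2 w2))// /a; lra.
have sa : 0 < (a / 2) ^+ 2 < a ^+ 2.
  rewrite exprn_gt0 ?divr_gt0//= ltrXn2r// ?nnegrE ?divr_ge0 ?ltW//.
  by rewrite ltr_pdivrMr// ltr_pMr// ltr1n.
exists (e / 2), ((a / 2) ^+ 2), (bump_mass ((a / 2) ^+ 2)); split.
- by rewrite divr_gt0.
- apply: (bump_mass_gt0 (z := z0) a0); apply: boxD; apply: ballxx; by rewrite divr_gt0.
move=> z /boxD zD; have sa' : (a / 2) ^+ 2 <= a ^+ 2 by case/andP : sa => _ /ltW.
split; first by apply: zD; rewrite /cbox/= !subrr normr0 ltW.
move=> u u1 hu; split.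
  by rewrite (reproducing u1 hu a0 zD sa) (potential_cst1 a0 zD sa') mulrC.
exact: (@green_identity _ u 0 _ z a).
Qed.

End reproducing.

(** * The orthogonal projection onto the harmonic functions *)

Section projection.
Context {R : realType}.
Local Notation plane := (R * R)%type.
Local Notation mplane := (measurableTypeR R * measurableTypeR R)%type.
Implicit Types (u v f g h : plane -> R) (z w : plane).

Definition rL2h v := real_harmonicD v /\ rL2 v.

Definition sqdist f g : R := intD (fun z => (f z - g z) ^+ 2).

Lemma sqdist_ge0 f g : 0 <= sqdist f g.
Proof. exact: intD_sqr_ge0. Qed.

(** Fatou's lemma carries an L^2 bound to a pointwise limit, including the
    square-integrability of that limit. *)
Lemma fatou_L2 g (f : nat -> plane -> R) h (e : R) : rL2 g -> (forall n, rL2 (f n)) ->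
  (forall z, disk z -> f n z @[n --> \oo] --> h z) ->
  (forall n, sqdist g (f n) <= e) ->
  rL2 (fun z => g z - h z) /\ sqdist g h <= e.
Proof.
move=> Lg Lf fh fe.
have mh : measurable_fun (disk : set mplane) h.
  by apply: measurable_fun_cvg fh => n; exact: rL2_measurable.
have mgh : measurable_fun (disk : set mplane) (fun z => g z - h z).
  by apply: measurable_funB => //; exact: rL2_measurable.
have Lgf n : L1D (fun z => (g z - f n z) ^+ 2) by case: (rL2B Lg (Lf n)).
have key : (\int[dA]_(z in (disk : set mplane)) ((g z - h z) ^+ 2)%:E <= e%:E)%E.
  rewrite (_ : integral _ _ _ = (\int[dA]_(z in (disk : set mplane))
      limn_einf (fun n => ((g z - f n z) ^+ 2)%:E))%E); last first.
    apply: eq_integral => z /set_mem Dz; apply/esym.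
    apply: (cvg_limn_einf_sup _).1; apply/fine_cvgP; split; first exact: nearW.
    suff H : g z - f n z @[n --> \oo] --> g z - h z.
      exact: (cvg_comp _ _ H (@exprn_continuous R 2 _)).
    by apply: cvgB; [exact: cvg_cst|exact: fh].
  apply: (le_trans (fatou _ measurable_disk _ _)).
  - by move=> n; apply/measurable_EFinP; exact: L1D_measurable.
  - by move=> n z _; rewrite lee_fin sqr_ge0.
  rewrite limn_einf_lim; apply: lime_le; first exact: is_cvg_einfs.
  apply: nearW => n.
  have := integrable_fin_num measurable_disk (Lgf n).
  move=> /fineK intE.
  apply: (@le_trans _ _ (\int[dA]_(z in (disk : set mplane)) ((g z - f n z) ^+ 2)%:E)%E).
    by apply: ereal_inf_lbound; exists n => //=.
  by rewrite -intE lee_fin; exact: fe.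
have I : L1D (fun z => (g z - h z) ^+ 2).
  apply/integrableP; split; first by apply/measurable_EFinP; exact: measurable_funX.
  apply: le_lt_trans (ltry e); apply: le_trans key.
  apply: ge0_le_integral => //; first exact: measurable_disk.
  - by apply: measurableT_comp => //; apply/measurable_EFinP; exact: measurable_funX.
  - by apply/measurable_EFinP; exact: measurable_funX.
  by move=> z _; rewrite /= lee_fin ger0_norm ?sqr_ge0.
split; first by split.
have := integrable_fin_num measurable_disk I => /fineK intE.
by rewrite -lee_fin /sqdist /intD /Rintegral intE.
Qed.

Lemma potential_lipschitz u v i j n s z : rL2 u -> rL2 v ->
  (potential u i j n s z - potential v i j n s z) ^+ 2 <=
  sqdist u v * intD (fun w => bump_moment i j n s z w ^+ 2).
Proof.
move=> Lu Lv; rewrite /potential -intDB; [|by apply/L1D_bump_moment/rL2_L1D..].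
rewrite (@eq_intD _ _ (fun w => (u w - v w) * bump_moment i j n s z w)); last by move=> w _; ring.
by apply: cauchy_schwarzD; [exact: rL2B|exact: bump_moment_rL2].
Qed.

Lemma norm_le_of_sqr (x e : R) : 0 < e -> x ^+ 2 <= e ^+ 2 -> `|x| <= e.
Proof.
by move=> e0 xe; rewrite -(@ler_pXn2r _ 2) ?nnegrE ?(ltW e0)// real_normK ?num_real.
Qed.

Lemma potential_cvg (f : nat -> plane -> R) h i j n s z : rL2 h ->
  (forall m, rL2 (f m)) -> sqdist (f m) h @[m --> \oo] --> (0:R) ->
  potential (f m) i j n s z @[m --> \oo] --> potential h i j n s z.
Proof.
move=> Lh Lf fh; apply/cvgrPdist_le => e e0.
pose K := intD (fun w => bump_moment i j n s z w ^+ 2).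
have K0 : 0 <= K by exact: intD_sqr_ge0.
have K1 : 0 < K + 1 by rewrite ltr_wpDl.
have d0 : 0 < e ^+ 2 / (K + 1) by rewrite divr_gt0// exprn_gt0.
move/cvgr0Pnorm_le : fh => /(_ _ d0); apply: filterS => m fm.
apply: norm_le_of_sqr => //; rewrite -sqrrN opprB.
apply: (le_trans (potential_lipschitz _ _ _ _ _ (Lf m) Lh)).
move: fm; rewrite ger0_norm ?sqdist_ge0// => fm.
apply: (@le_trans _ _ (e ^+ 2 / (K + 1) * K)); first by rewrite ler_wpM2r.
by rewrite mulrAC ler_pdivrMr// ler_wpM2l ?sqr_ge0// lerDl.
Qed.

(** By the reproducing formula and the Cauchy-Schwarz inequality, evaluation at z
    is continuous for the L^2 norm on harmonic functions. *)
Lemma rL2h_pointwise_cauchy (f : nat -> plane -> R) z : disk z ->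
  (forall n, rL2h (f n)) ->
  (forall e : R, 0 < e -> exists N, forall n m, (N <= n)%N -> (N <= m)%N ->
     sqdist (f n) (f m) <= e) ->
  cvgn (fun n => f n z).
Proof.
move=> Dz Lf fC; have [a [s [c [a0 c0 /(_ z (ballxx _ a0))[_ rep]]]]] := local_reproducing Dz.
have cf n : potential (f n) 0 0 3 s z = c * f n z.
  by have [hn Ln] := Lf n; have [] := rep _ (rL2_L1D Ln) hn.
pose K := intD (fun w => bump_moment 0 0 3 s z w ^+ 2).
have K0 : 0 <= K by exact: intD_sqr_ge0.
have K1 : 0 < K + 1 by rewrite ltr_wpDl.
apply/cauchy_cvgP/cauchy_ballP => e e0; near_simpl.
have d0 : 0 < (c * (e / 2)) ^+ 2 / (K + 1) by rewrite divr_gt0// exprn_gt0// mulr_gt0// divr_gt0.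
have [N HN] := fC _ d0.
exists ([set n | (N <= n)%N], [set n | (N <= n)%N]).
  by split; exact: nbhs_infty_ge.
move=> [n m] [/= nN mN]; rewrite -ball_normE /=.
apply: (@le_lt_trans _ _ (e / 2)); last by rewrite ltr_pdivrMr// ltr_pMr// ltr1n.
rewrite -(ler_pM2l c0) -{1}(gtr0_norm c0) -normrM mulrBr -!cf.
apply: norm_le_of_sqr; first by rewrite mulr_gt0// divr_gt0.
apply: (le_trans (potential_lipschitz _ _ _ _ _ (Lf _).2 (Lf _).2)).
apply: (@le_trans _ _ ((c * (e / 2)) ^+ 2 / (K + 1) * K)); first by rewrite ler_wpM2r// HN.
by rewrite mulrAC ler_pdivrMr// ler_wpM2l ?sqr_ge0// lerDl.
Qed.

(** Near each point h is a multiple of an integral of h against a kernel of class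
    C^2, and the integrals expressing its Laplacian satisfy the relation that holds
    for every term of the sequence. *)
Lemma harmonic_L2_limit (f : nat -> plane -> R) h : rL2 h ->
  (forall n, rL2h (f n)) -> (forall z, disk z -> f n z @[n --> \oo] --> h z) ->
  sqdist (f n) h @[n --> \oo] --> (0:R) -> real_harmonicD h.
Proof.
move=> Lh Lf fh f0; have h1 := rL2_L1D Lh.
have pc i j n s z : potential (f m) i j n s z @[m --> \oo] --> potential h i j n s z.
  exact: (potential_cvg Lh (fun m => (Lf m).2) f0).
have loc z0 : disk z0 -> exists s c : R, [/\ c != 0,
    \near z0, c^-1 * potential h 0 0 3 s z0 - 0 * potential h 0 0 3 s z0 = h z0 &
    2 * s * potential h 0 0 1 s z0 = 3 * potential h 0 0 2 s z0].
  move=> Dz; have [a [s [c [a0 c0 rep]]]] := local_reproducing Dz.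
  (* The zero summand gives the expression the shape of [globalC_lin]. *)
  exists s, c; split; first by rewrite gt_eqF.
    have nb : \forall z \near z0, ball z0 a z by exact: nbhsx_ballx.
    apply: filterS nb => z /rep[zD {}rep].
    have e1 : c * h z = potential h 0 0 3 s z.
      have l1 : c * f n z @[n --> \oo] --> c * h z.
        by apply: cvgM; [exact: cvg_cst|exact: fh].
      have E : (fun n => potential (f n) 0 0 3 s z) = (fun n => c * f n z).
        by apply/funext => n; have [] := rep _ (rL2_L1D (Lf n).2) (Lf n).1.
      have := pc 0 0 3 s z; rewrite E => l2; exact: (cvg_unique _ l1 l2).
    by rewrite -e1 mul0r subr0 mulKf// gt_eqF.
  have [zD {}rep] := rep z0 (ballxx _ a0).
  have l1 : 2 * s * potential (f n) 0 0 1 s z0 @[n --> \oo] --> 2 * s * potential h 0 0 1 s z0.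
    by apply: cvgM; [exact: cvg_cst|exact: pc].
  have l2 : 3 * potential (f n) 0 0 2 s z0 @[n --> \oo] --> 3 * potential h 0 0 2 s z0.
    by apply: cvgM; [exact: cvg_cst|exact: pc].
  have E : (fun n => 2 * s * potential (f n) 0 0 1 s z0) =
      (fun n => 3 * potential (f n) 0 0 2 s z0).
    by apply/funext => n; have [] := rep _ (rL2_L1D (Lf n).2) (Lf n).1.
  by rewrite E in l1; exact: (cvg_unique _ l1 l2).
have gC s : globalC 2 (potential h 0 0 3 s) by exact: (globalC_potential 2 0 0 0 s h1).
split.
  apply: classC_local => z0 /loc[s [c [c0 hE _]]].
  exists (fun z => c^-1 * potential h 0 0 3 s z - 0 * potential h 0 0 3 s z) => //.
  exact: globalC_lin.
move=> z0 /set_mem /loc[s [c [c0 hE E]]].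
have hE' : \near z0, h z0 = c^-1 * potential h 0 0 3 s z0.
  by apply: filterS hE => z <-; rewrite mul0r subr0.
have dE e : e = e1 \/ e = e2 -> 'D_e ('D_e h) z0 =
    c^-1 * 'D_e ('D_e (potential h 0 0 3 s)) z0.
  move=> eE.
  have [_ [g1 [g2 [d1 d2 [_ [g11 [g12 [d11 _ _ _]]]] [_ [g21 [g22 [_ d22 _ _]]]]]]]] := gC s.
  have D1 z : derivable (potential h 0 0 3 s) z e.
    by case: eE => ->; exact: ex_derive.
  have D2 z : derivable ('D_e (potential h 0 0 3 s)) z e.
    case: eE => ->.
      have -> : 'D_e1 (potential h 0 0 3 s) = g1 by apply/funext => w; rewrite derive_val.
      exact: ex_derive.
    have -> : 'D_e2 (potential h 0 0 3 s) = g2 by apply/funext => w; rewrite derive_val.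
    exact: ex_derive.
  have step : \near z0, 'D_e h z0 = c^-1 * 'D_e (potential h 0 0 3 s) z0.
    apply: filterS (near_near_eq hE') => z hz.
    by rewrite (near_eq_derive _ hz) (deriveZ c^-1 (D1 z)).
  by rewrite (near_eq_derive _ step) (deriveZ c^-1 (D2 z0)).
rewrite /laplacian (dE e1); last by left.
rewrite (dE e2); last by right.
have := laplacian_potential s z0 h1; rewrite /laplacian E subrr mulr0 => L0.
by rewrite -mulrDr L0 mulr0.
Qed.

Lemma rL2h_addZ (t : R) f g : rL2h f -> rL2h g -> rL2h (fun z => f z + t * g z).
Proof.
move=> [hf Lf] [hg Lg]; split; first exact: harmonic_addZ.
by apply: rL2D => //; exact: rL2Z.
Qed.

Lemma parallelogram v f g : rL2 v -> rL2 f -> rL2 g ->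
  sqdist f g = 2 * sqdist v f + 2 * sqdist v g -
  4 * sqdist v (fun z => 2^-1 * f z + 2^-1 * g z).
Proof.
move=> Lv Lf Lg; rewrite /sqdist.
have L1 : L1D (fun z => (v z - f z) ^+ 2) by case: (rL2B Lv Lf).
have L2 : L1D (fun z => (v z - g z) ^+ 2) by case: (rL2B Lv Lg).
have L3 : L1D (fun z => (v z - (2^-1 * f z + 2^-1 * g z)) ^+ 2).
  by case: (rL2B Lv (rL2D (rL2Z 2^-1 Lf) (rL2Z 2^-1 Lg))).
rewrite -!intDZ// -intDD; [|exact: L1DZ..].
rewrite -intDB; [|by apply: L1DD; exact: L1DZ|exact: L1DZ].
by apply: eq_intD => z _; field.
Qed.

(** The last clause says that the limit inherits every eventual bound on the
    distance to a fixed v, so that the limit of a sequence minimizing this distance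
    attains the minimum. *)
Lemma rL2h_complete (f : nat -> plane -> R) : (forall n, rL2h (f n)) ->
  (forall e : R, 0 < e -> exists N, forall n m, (N <= n)%N -> (N <= m)%N ->
     sqdist (f n) (f m) <= e) ->
  exists2 h, rL2h h & forall v (e : R), rL2 v ->
    (exists N, forall n, (N <= n)%N -> sqdist v (f n) <= e) -> sqdist v h <= e.
Proof.
move=> Lf fC; pose h z := limn (fun n => f n z).
have fh z : disk z -> f n z @[n --> \oo] --> h z.
  by move=> Dz; exact: rL2h_pointwise_cauchy.
have shift N z : disk z -> f (n + N)%N z @[n --> \oo] --> h z.
  by move=> Dz; rewrite (cvg_shiftn N (fun n => f n z)); exact: fh.
have lim v e N : rL2 v -> (forall n, (N <= n)%N -> sqdist v (f n) <= e) ->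
    rL2 (fun z => v z - h z) /\ sqdist v h <= e.
  move=> Lv H; apply: (fatou_L2 Lv (f := fun n => f (n + N)%N)).
  - by move=> n; exact: (Lf _).2.
  - exact: shift.
  - by move=> n; apply: H; exact: leq_addl.
have Lh : rL2 h.
  have [N HN] := fC 1 ltr01.
  have [Lfh _] := lim (f N) 1 N (Lf N).2 (fun n Nn => HN N n (leqnn _) Nn).
  have := rL2B (Lf N).2 Lfh.
  by rewrite (_ : (fun z => _) = h)//; apply/funext => z; ring.
have f0 : sqdist (f n) h @[n --> \oo] --> (0:R).
  apply/cvgr0Pnorm_le => e e0; have [N HN] := fC e e0.
  exists N => // n /= Nn; rewrite ger0_norm ?sqdist_ge0//.
  by have [] := lim (f n) e N (Lf n).2 (fun m Nm => HN n m Nn Nm).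
exists h; first by split=> //; exact: (harmonic_L2_limit Lh Lf fh f0).
by move=> v e Lv [N HN]; have [] := lim v e N Lv HN.
Qed.

(** The parallelogram law makes a minimizing sequence Cauchy, and minimality of the
    limit along every line h + t g forces the orthogonality. *)
Lemma rL2h_projection v : rL2 v -> exists2 h, rL2h h &
  forall g, rL2h g -> intD (fun z => (v z - h z) * g z) = 0.
Proof.
move=> Lv; pose S := [set x | exists2 g, rL2h g & x = sqdist v g].
have L0 : rL2h (cst 0 : plane -> R) by split; [exact: harmonic_cst|exact: rL2_cst].
have Slb : has_lbound S by exists 0 => _ [g _ ->]; exact: sqdist_ge0.
have S0 : S !=set0 by exists (sqdist v (cst 0)), (cst 0).
pose d := inf S.
have dle g : rL2h g -> d <= sqdist v g by move=> Lg; apply: ge_inf => //; exists g.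
have minimizing (n : nat) : exists g, rL2h g /\ sqdist v g < d + n.+1%:R^-1.
  have n0 : 0 < (n.+1%:R^-1 : R) by rewrite invr_gt0.
  by have [_ [g Lg ->] H] := inf_adherent n0 (conj S0 Slb); exists g.
have [f Hf] := choice minimizing.
have Lf n : rL2h (f n) by case: (Hf n).
have fd n N : (N <= n)%N -> sqdist v (f n) <= d + N.+1%:R^-1.
  move=> Nn; have [_ /ltW H] := Hf n; apply: le_trans H _; rewrite lerD2l.
  by rewrite lef_pV2 ?posrE// ler_nat.
have small (e : R) : 0 < e -> exists N : nat, N.+1%:R^-1 <= e.
  move=> e0; have [N _ /(_ N (leqnn _)) H] := near_infty_natSinv_lt (PosNum e0).
  by exists N; apply: ltW.
have [|h Lh Hh] := rL2h_complete Lf.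
  move=> e e0; have [N Ne] := small (e / 4) (divr_gt0 e0 (ltr0Sn _ 3)); exists N => n m Nn Nm.
  rewrite (parallelogram Lv (Lf n).2 (Lf m).2).
  have Lm : rL2h (fun z => 2^-1 * f n z + 2^-1 * f m z).
    have := rL2h_addZ 2^-1 (rL2h_addZ 2^-1 L0 (Lf n)) (Lf m).
    rewrite (_ : (fun z => _) = (fun z => 2^-1 * f n z + 2^-1 * f m z))//.
    by apply/funext => z; rewrite /= add0r.
  have := dle _ Lm; have := fd n N Nn; have := fd m N Nm.
  by move: (N.+1%:R^-1) Ne => r Ne; lra.
have hd : sqdist v h <= d.
  apply/ler_addgt0Pr => e e0; apply: Hh => //.
  by have [N Ne] := small e e0; exists N => n /fd H; apply: le_trans H _; rewrite lerD2l.
exists h => // g Lg.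
have Lvh : rL2 (fun z => v z - h z) by exact: rL2B Lv Lh.2.
have Q t : 0 <= - 2 * t * intD (fun z => (v z - h z) * g z) + t ^+ 2 * intD (fun z => g z ^+ 2).
  have := dle _ (rL2h_addZ t Lh Lg).
  rewrite /sqdist (@eq_intD _ _ (fun z => ((v z - h z) - t * g z) ^+ 2)); last by move=> z _; ring.
  by rewrite (intD_sqrB t Lvh Lg.2) -/(sqdist v h) => H; have := hd; lra.
move: (intD (fun z => g z ^+ 2)) (intD_sqr_ge0 g) Q => b b0.
move: (intD _) => p Q; apply/eqP; apply: contraT => p0.
have p2 : 0 < p ^+ 2 by rewrite exprn_even_gt0.
have b1 : 0 < b + 1 by rewrite ltr_wpDl.
(* The quadratic polynomial bounded below in Q is negative at this t. *)
have := Q (p / (b + 1)).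
rewrite (_ : _ + _ = - (p ^+ 2 * (b + 2) / (b + 1) ^+ 2)); last by field; rewrite gt_eqF.
rewrite oppr_ge0 leNgt divr_gt0 ?exprn_gt0// mulr_gt0//.
by rewrite ltr_wpDl.
Qed.

End projection.

(** * The bilinear form and the commutator *)

Section complex_L2.
Context {R : realType}.
Local Notation C := R[i].
Local Notation plane := (R * R)%type.
Local Notation mplane := (measurableTypeR R * measurableTypeR R)%type.
Local Notation Re := (@complex.Re R).
Local Notation Im := (@complex.Im R).
Implicit Types (f g h u v q phi psi : plane -> C) (z w : plane).

Lemma ReM (x y : C) : Re (x * y) = Re x * Re y - Im x * Im y.
Proof. by case: x; case: y. Qed.

Lemma ImM (x y : C) : Im (x * y) = Re x * Im y + Im x * Re y.
Proof. by case: x; case: y. Qed.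

Lemma ReD (x y : C) : Re (x + y) = Re x + Re y.
Proof. by case: x; case: y. Qed.

Lemma ImD (x y : C) : Im (x + y) = Im x + Im y.
Proof. by case: x; case: y. Qed.

Lemma ReN (x : C) : Re (- x) = - Re x. Proof. by case: x. Qed.
Lemma ImN (x : C) : Im (- x) = - Im x. Proof. by case: x. Qed.
Lemma Re_conjc (x : C) : Re (conjc x) = Re x. Proof. by case: x. Qed.
Lemma Im_conjc (x : C) : Im (conjc x) = - Im x. Proof. by case: x. Qed.

Lemma eq_Re_Im (x y : C) : Re x = Re y -> Im x = Im y -> x = y.
Proof. by case: x y => a b [c d] /= -> ->. Qed.

Definition cconj f : plane -> C := fun z => conjc (f z).

Lemma cconjK f : cconj (cconj f) = f.
Proof. by apply/funext => z; rewrite /cconj conjcK. Qed.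

Lemma ae_imp (P Q : plane -> Prop) : {ae dA (R := R), forall z, P z} ->
  (forall z, P z -> Q z) -> {ae dA (R := R), forall z, Q z}.
Proof.
move=> aeP PQ; have F := @ae_filter_ringOfSetsType _ mplane R (@dA R).
exact: (@filterS _ _ F _ _ PQ aeP).
Qed.

Definition cL1 f := L1D (fun z => Re (f z)) /\ L1D (fun z => Im (f z)).

Lemma eq_cintegral f g : (forall z, disk z -> f z = g z) -> cintegral f = cintegral g.
Proof.
move=> fg; rewrite /cintegral; congr Complex; apply: eq_intD => z Dz; by rewrite fg.
Qed.

Lemma cintegralD f g : cL1 f -> cL1 g ->
  cintegral (fun z => f z + g z) = cintegral f + cintegral g.
Proof.
move=> [f1 f2] [g1 g2]; apply: eq_Re_Im; rewrite ?ReD ?ImD /cintegral /=.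
  by rewrite -/(intD _) (@eq_intD _ _ (fun z => Re (f z) + Re (g z))) ?intDD// => z _; rewrite ReD.
by rewrite -/(intD _) (@eq_intD _ _ (fun z => Im (f z) + Im (g z))) ?intDD// => z _; rewrite ImD.
Qed.

Lemma cintegralZ (c : C) f : cL1 f -> cintegral (fun z => c * f z) = c * cintegral f.
Proof.
move=> [f1 f2]; apply: eq_Re_Im; rewrite ?ReM ?ImM /cintegral /= -![Rintegral _ _ _]/(intD _).
  rewrite (@eq_intD _ _ (fun z => Re c * Re (f z) - Im c * Im (f z))); last first.
    by move=> z _; rewrite ReM.
  by rewrite intDB ?intDZ//; exact: L1DZ.
rewrite (@eq_intD _ _ (fun z => Re c * Im (f z) + Im c * Re (f z))); last first.
  by move=> z _; rewrite ImM.
by rewrite intDD ?intDZ//; exact: L1DZ.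
Qed.

Lemma cintegral_conj f : cL1 f -> cintegral (cconj f) = conjc (cintegral f).
Proof.
move=> [f1 f2]; apply: eq_Re_Im;
  rewrite ?Re_conjc ?Im_conjc /cintegral /= -![Rintegral _ _ _]/(intD _).
  by apply: eq_intD => z _; rewrite Re_conjc.
rewrite (@eq_intD _ _ (fun z => -1 * Im (f z))); last by move=> z _; rewrite Im_conjc mulN1r.
by rewrite intDZ// mulN1r.
Qed.

Lemma normc_sqr (x : C) : Normc.normc x ^+ 2 = Re x ^+ 2 + Im x ^+ 2.
Proof. by case: x => a b /=; rewrite sqr_sqrtr// addr_ge0 ?sqr_ge0. Qed.

Lemma L2_Re_Im f : L2 f <-> rL2 (fun z => Re (f z)) /\ rL2 (fun z => Im (f z)).
Proof.
have E z : Normc.normc (f z) ^+ 2 = Re (f z) ^+ 2 + Im (f z) ^+ 2 by exact: normc_sqr.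
split=> [[[mr mi] fi]|[[mr fr] [mi fi]]].
  have {}fi : L1D (fun z => Re (f z) ^+ 2 + Im (f z) ^+ 2).
    by apply: (eq_L1D _ fi) => z _; rewrite /= E.
  split; split=> //; apply: (le_L1D _ _ fi).
  - exact: measurable_funX.
  - by move=> z _; rewrite ger0_norm ?sqr_ge0// lerDl sqr_ge0.
  - exact: measurable_funX.
  - by move=> z _; rewrite ger0_norm ?sqr_ge0// lerDr sqr_ge0.
by split=> //; apply: (eq_L1D _ (L1DD fr fi)) => z _; rewrite /= E.
Qed.

Lemma L2D f g : L2 f -> L2 g -> L2 (fun z => f z + g z).
Proof.
move=> /L2_Re_Im[f1 f2] /L2_Re_Im[g1 g2]; apply/L2_Re_Im; split.
  by under eq_fun do rewrite ReD; exact: rL2D.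
by under eq_fun do rewrite ImD; exact: rL2D.
Qed.

Lemma L2Z (c : C) f : L2 f -> L2 (fun z => c * f z).
Proof.
move=> /L2_Re_Im[f1 f2]; apply/L2_Re_Im; split.
  by under eq_fun do rewrite ReM; apply: rL2B; exact: rL2Z.
by under eq_fun do rewrite ImM; apply: rL2D; exact: rL2Z.
Qed.

Lemma L2B f g : L2 f -> L2 g -> L2 (fun z => f z - g z).
Proof. by move=> f2 /(L2Z (-1)) g2; under eq_fun do rewrite -mulN1r; exact: L2D. Qed.

Lemma L2_conj f : L2 f -> L2 (cconj f).
Proof.
move=> /L2_Re_Im[f1 f2]; apply/L2_Re_Im; split.
  by under eq_fun do rewrite Re_conjc.
by under eq_fun do rewrite Im_conjc -mulN1r; exact: rL2Z.
Qed.

Lemma L2_mul f g : L2 f -> L2 g -> cL1 (fun z => f z * g z).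
Proof.
move=> /L2_Re_Im[f1 f2] /L2_Re_Im[g1 g2]; split.
  by under eq_fun do rewrite ReM; apply: L1DB; exact: rL2_mul.
by under eq_fun do rewrite ImM; apply: L1DD; exact: rL2_mul.
Qed.

Lemma L2_mul_Linfty phi f : Linfty phi -> L2 f -> L2 (fun z => phi z * f z).
Proof.
move=> [[mr mi] [M HM]] Lf; have [[fr _] [fi _]] := (L2_Re_Im f).1 Lf.
have mR : measurable_fun (disk : set mplane) (fun z => Re (phi z * f z)).
  under eq_fun do rewrite ReM; apply: measurable_funB; exact: measurable_funM.
have mI : measurable_fun (disk : set mplane) (fun z => Im (phi z * f z)).
  under eq_fun do rewrite ImM; apply: measurable_funD; exact: measurable_funM.
have E z : Normc.normc (phi z * f z) ^+ 2 = Normc.normc (phi z) ^+ 2 * Normc.normc (f z) ^+ 2.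
  by rewrite !normc_sqr ReM ImM; ring.
split=> //; apply/integrableP; split.
  apply/measurable_EFinP; under eq_fun do rewrite normc_sqr.
  by apply: measurable_funD; exact: measurable_funX.
have If : L1D (fun z => M ^+ 2 * Normc.normc (f z) ^+ 2) by apply: L1DZ; exact: Lf.2.
move/integrableP : If => [mf fin]; apply: le_lt_trans fin.
apply: ae_ge0_le_integral; first exact: measurable_disk.
- by [].
- apply: measurableT_comp => //; apply/measurable_EFinP; under eq_fun do rewrite normc_sqr.
  by apply: measurable_funD; exact: measurable_funX.
- by [].
- exact: measurableT_comp.
apply: (ae_imp HM) => z {}HM Dz; have zM := HM Dz.
have n0 : 0 <= Normc.normc (phi z) by case: (phi z) => a b /=; exact: sqrtr_ge0.
rewrite lee_fin E !(ger0_norm (mulr_ge0 (sqr_ge0 _) (sqr_ge0 _))) ler_wpM2r ?sqr_ge0//.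
by rewrite lerXn2r ?nnegrE//; exact: le_trans zM.
Qed.

(** No conjugate on the second argument: this is what makes multiplication
    operators symmetric. *)
Definition bilin f g : C := cintegral (fun z => f z * g z).

Lemma bilinC f g : bilin f g = bilin g f.
Proof. by apply: eq_cintegral => z _; rewrite mulrC. Qed.

Lemma bilinDl f g h : L2 f -> L2 g -> L2 h ->
  bilin (fun z => f z + g z) h = bilin f h + bilin g h.
Proof.
move=> Lf Lg Lh; rewrite -cintegralD; [|exact: L2_mul..].
by apply: eq_cintegral => z _; rewrite mulrDl.
Qed.

Lemma bilinZl (c : C) f h : L2 f -> L2 h -> bilin (fun z => c * f z) h = c * bilin f h.
Proof.
move=> Lf Lh; rewrite -cintegralZ; last exact: L2_mul.
by apply: eq_cintegral => z _; rewrite mulrA.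
Qed.

Lemma bilinBl f g h : L2 f -> L2 g -> L2 h ->
  bilin (fun z => f z - g z) h = bilin f h - bilin g h.
Proof.
move=> Lf Lg Lh.
rewrite (_ : (fun z => _) = (fun z => f z + -1 * g z)); last by apply/funext => z; rewrite mulN1r.
by rewrite bilinDl ?bilinZl ?mulN1r//; exact: L2Z.
Qed.

Lemma L2_0 : L2 (fun=> 0 : C).
Proof. by apply/L2_Re_Im; split; exact: rL2_cst. Qed.

Lemma L2_sum (I : Type) (s : seq I) (c : I -> C) (b : I -> plane -> C) :
  (forall i, L2 (b i)) -> L2 (fun z => \sum_(i <- s) c i * b i z).
Proof.
move=> Lb; elim: s => [|i s IH].
  by under eq_fun do rewrite big_nil; exact: L2_0.
by under eq_fun do rewrite big_cons; apply: L2D => //; exact: L2Z.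
Qed.

Lemma bilin_suml (I : Type) (s : seq I) (c : I -> C) (b : I -> plane -> C) h :
  (forall i, L2 (b i)) -> L2 h ->
  bilin (fun z => \sum_(i <- s) c i * b i z) h = \sum_(i <- s) c i * bilin (b i) h.
Proof.
move=> Lb Lh; elim: s => [|i s IH].
  rewrite big_nil (_ : (fun z => _) = (fun z => 0 * (0:C))); last first.
    by apply/funext => z; rewrite big_nil mul0r.
  by rewrite (@bilinZl 0 (fun=> 0)) ?mul0r//; exact: L2_0.
rewrite big_cons -IH -bilinZl// -bilinDl//; [|exact: L2Z|exact: L2_sum].
by apply: eq_cintegral => z _; rewrite big_cons.
Qed.

Lemma ae_eq_bilin f g h : L2 f -> L2 g -> L2 h -> ae_eqD f g -> bilin f h = bilin g h.
Proof.
move=> Lf Lg Lh fg.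
have [f1 f2] := L2_mul Lf Lh; have [g1 g2] := L2_mul Lg Lh.
have fg' : {ae dA, forall z, disk z -> f z = g z} := fg.
rewrite /bilin /cintegral; congr Complex; rewrite /Rintegral; congr fine.
  apply: ae_eq_integral; first exact: measurable_disk.
  - by apply/measurable_EFinP; exact: L1D_measurable.
  - by apply/measurable_EFinP; exact: L1D_measurable.
  - by apply: (ae_imp fg') => z {}fg Dz; rewrite fg.
apply: ae_eq_integral; first exact: measurable_disk.
- by apply/measurable_EFinP; exact: L1D_measurable.
- by apply/measurable_EFinP; exact: L1D_measurable.
- by apply: (ae_imp fg') => z {}fg Dz; rewrite fg.
Qed.

Lemma bilin_conj_eq0 f : L2 f -> bilin f (cconj f) = 0 -> ae_eqD f (fun=> 0).
Proof.
move=> Lf; rewrite /bilin /cintegral /cconj => /(congr1 Re) /=.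
rewrite -/(intD _) (@eq_intD _ _ (fun z => Re (f z) ^+ 2 + Im (f z) ^+ 2)); last first.
  by move=> z _; rewrite ReM Re_conjc Im_conjc; ring.
have [[mr fr] [mi fi]] := (L2_Re_Im f).1 Lf; have I := L1DD fr fi.
move=> I0.
have : (\int[dA]_(z in (disk : set mplane)) `|(Re (f z) ^+ 2 + Im (f z) ^+ 2)%:E| = 0)%E.
  under eq_integral do rewrite /= ger0_norm ?addr_ge0 ?sqr_ge0//.
  by rewrite -(fineK (integrable_fin_num measurable_disk I)); congr EFin.
move=> /(ae_eq_integral_abs dA measurable_disk) H.
have {H} := H (measurable_int dA I); apply: filterS => z + Dz => /(_ Dz) [] /eqP.
rewrite paddr_eq0 ?sqr_ge0// !sqrf_eq0 => /andP[/eqP r0 /eqP i0].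
exact: eq_Re_Im.
Qed.

Lemma L2h_conj h : L2h h -> L2h (cconj h).
Proof.
move=> [[hr hi] Lh]; split; last exact: L2_conj.
split.
  by rewrite (_ : Re \o cconj h = Re \o h)//; apply/funext => z /=; rewrite Re_conjc.
rewrite (_ : Im \o cconj h = (fun z => cst 0 z + -1 * (Im \o h) z)).
  by exact: (harmonic_addZ (-1) (harmonic_cst 0) hi).
by apply/funext => z /=; rewrite Im_conjc mulN1r add0r.
Qed.

Lemma L2h_L2 h : L2h h -> L2 h. Proof. by case. Qed.
Lemma L2h_perp_L2 f : L2h_perp f -> L2 f. Proof. by case. Qed.

(** Orthogonality for the inner product and for the bilinear form agree because the
    harmonic functions are stable under conjugation. *)
Lemma L2h_perpP f : L2h_perp f <-> L2 f /\ forall h, L2h h -> bilin f h = 0.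
Proof.
split=> -[Lf H]; split=> // h /L2h_conj Lh; last exact: H.
by have := H _ Lh; rewrite /inner -/(cconj (cconj h)) -[X in _ -> bilin f X = 0](cconjK h).
Qed.

Lemma L2h_perp_conj f : L2h_perp f -> L2h_perp (cconj f).
Proof.
move=> /L2h_perpP[Lf H]; apply/L2h_perpP; split=> [|h Lh]; first exact: L2_conj.
have := H _ (L2h_conj Lh); rewrite /bilin => E.
rewrite -[RHS](conjc0 R) -E -cintegral_conj; last by apply: L2_mul => //; exact/L2_conj/L2h_L2.
by apply: eq_cintegral => z _; rewrite /cconj rmorphM /= conjcK.
Qed.

Lemma L2h_perp_sum (I : Type) (s : seq I) (c : I -> C) (b : I -> plane -> C) :
  (forall i, L2h_perp (b i)) -> L2h_perp (fun z => \sum_(i <- s) c i * b i z).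
Proof.
move=> Hb; have Lb i := L2h_perp_L2 (Hb i); apply/L2h_perpP; split; first exact: L2_sum.
move=> h Lh; rewrite bilin_suml//; last exact: L2h_L2.
by apply: big1 => i _; have [_ ->] := (L2h_perpP _).1 (Hb i); rewrite ?mulr0.
Qed.

Lemma L2h_perpB f g : L2h_perp f -> L2h_perp g -> L2h_perp (fun z => f z - g z).
Proof.
move=> /L2h_perpP[Lf Hf] /L2h_perpP[Lg Hg]; apply/L2h_perpP; split; first exact: L2B.
by move=> h Lh; rewrite bilinBl ?Hf ?Hg ?subrr//; exact: L2h_L2.
Qed.

(** Real and imaginary parts are projected separately; the real orthogonality
    relations recombine into the complex one. *)
Lemma L2h_projP f : L2 f -> L2h (L2h_proj f) /\ L2h_perp (fun z => f z - L2h_proj f z).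
Proof.
move=> Lf; rewrite /L2h_proj.
apply: (xgetPex (fun=> 0) (P := [set h | L2h h /\ L2h_perp (fun z => f z - h z)])).
have [fr fi] := (L2_Re_Im f).1 Lf.
have [hr [hrh hrL] Hr] := rL2h_projection fr.
have [hi [hih hiL] Hi] := rL2h_projection fi.
have Lh : L2h (fun z => Complex (hr z) (hi z)).
  split; first by split; [exact: hrh|exact: hih].
  by apply/L2_Re_Im; split; [exact: hrL|exact: hiL].
exists (fun z => Complex (hr z) (hi z)); split=> //; apply/L2h_perpP.
have Lfh : L2 (fun z => f z - Complex (hr z) (hi z)) by apply: L2B => //; exact: L2h_L2.
split=> // g [[gr gi] Lg]; have [gr2 gi2] := (L2_Re_Im g).1 Lg.
have rr := rL2B fr hrL; have ii := rL2B fi hiL.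
apply: eq_Re_Im; rewrite /bilin /cintegral /= -/(intD _).
  rewrite (@eq_intD _ _ (fun z => (Re (f z) - hr z) * Re (g z) - (Im (f z) - hi z) * Im (g z))).
    rewrite intDB; [|exact: rL2_mul..].
    have Er : intD (fun z => (Re (f z) - hr z) * Re (g z)) = 0 := Hr _ (conj gr gr2).
    have Ei : intD (fun z => (Im (f z) - hi z) * Im (g z)) = 0 := Hi _ (conj gi gi2).
    by rewrite Er Ei subrr.
  by move=> z _; rewrite ReM ReD ImD ReN ImN.
rewrite (@eq_intD _ _ (fun z => (Re (f z) - hr z) * Im (g z) + (Im (f z) - hi z) * Re (g z))).
  rewrite intDD; [|exact: rL2_mul..].
  have Er : intD (fun z => (Re (f z) - hr z) * Im (g z)) = 0 := Hr _ (conj gi gi2).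
  have Ei : intD (fun z => (Im (f z) - hi z) * Re (g z)) = 0 := Hi _ (conj gr gr2).
  by rewrite Er Ei addr0.
by move=> z _; rewrite ImM ReD ImD ReN ImN.
Qed.

Lemma dual_toeplitz_perp phi u : Linfty phi -> L2h_perp u -> L2h_perp (dual_toeplitz phi u).
Proof.
by move=> hphi /L2h_perp_L2 Lu; have [] := L2h_projP (L2_mul_Linfty hphi Lu).
Qed.

Lemma bilin_dual_toeplitz phi u v : Linfty phi -> L2h_perp u -> L2h_perp v ->
  bilin (dual_toeplitz phi u) v = bilin (fun z => phi z * u z) v.
Proof.
move=> hphi Hu Hv; have Lu := L2_mul_Linfty hphi (L2h_perp_L2 Hu).
have [Lq _] := L2h_projP Lu; have [Lv Hv'] := (L2h_perpP _).1 Hv.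
rewrite bilinBl//; last exact: L2h_L2.
by rewrite (bilinC (L2h_proj _)) Hv'// subr0.
Qed.

(** The projected part of phi u is invisible to v, so both sides are the integral
    of phi u v. *)
Lemma dual_toeplitz_sym phi u v : Linfty phi -> L2h_perp u -> L2h_perp v ->
  bilin (dual_toeplitz phi u) v = bilin (dual_toeplitz phi v) u.
Proof.
move=> hphi Hu Hv; rewrite !bilin_dual_toeplitz//.
by apply: eq_cintegral => z _; ring.
Qed.

Lemma commutator_perp phi psi u : Linfty phi -> Linfty psi -> L2h_perp u ->
  L2h_perp (commutator phi psi u).
Proof.
by move=> hphi hpsi Hu; apply: L2h_perpB; do 2 apply: dual_toeplitz_perp => //.
Qed.

(** Moving the outer operator of each product to the other side expresses the form
    by bilin (S_phi v) (S_psi u) - bilin (S_psi v) (S_phi u), which changes sign when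
    u and v are exchanged. *)
Lemma commutator_skew phi psi u v : Linfty phi -> Linfty psi ->
  L2h_perp u -> L2h_perp v ->
  bilin (commutator phi psi u) v = - bilin (commutator phi psi v) u.
Proof.
move=> hphi hpsi Hu Hv.
have H (a w : plane -> C) : Linfty a -> L2h_perp w -> L2h_perp (dual_toeplitz a w).
  exact: dual_toeplitz_perp.
have E (w w' : plane -> C) : L2h_perp w -> L2h_perp w' -> bilin (commutator phi psi w) w' =
    bilin (dual_toeplitz phi w') (dual_toeplitz psi w) -
    bilin (dual_toeplitz psi w') (dual_toeplitz phi w).
  move=> Hw Hw'.
  have P1 := H phi _ hphi (H psi _ hpsi Hw); have P2 := H psi _ hpsi (H phi _ hphi Hw).
  rewrite bilinBl; [|exact: L2h_perp_L2..].
  exact: (congr2 (fun x y => x - y) (dual_toeplitz_sym hphi (H psi _ hpsi Hw) Hw')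
    (dual_toeplitz_sym hpsi (H phi _ hphi Hw) Hw')).
apply: (etrans (E u v Hu Hv)); apply/esym.
apply: (etrans (congr1 -%R (E v u Hv Hu))).
apply: (etrans (opprB _ _)).
exact: (congr2 (fun x y => x - y) (bilinC _ _) (bilinC _ _)).
Qed.

End complex_L2.

(** * Parity of the rank *)

Lemma skew_unitmx_even (F : numFieldType) (n : nat) (A : 'M[F]_n) :
  A^T = - A -> A \in unitmx -> ~~ odd n.
Proof.
move=> skew; rewrite unitmxE unitfE; apply: contra => on.
have := det_tr A; rewrite skew -scaleN1r detZ -signr_odd on expr1 mulN1r.
by move/eqP; rewrite eqNr.
Qed.

Local Close Scope classical_set_scope.

Theorem theorem4p1 (R : realType) (phi psi : R * R -> R[i])
    (hphi : Linfty phi) (hpsi : Linfty psi)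
    (hfin : finite_rank (commutator phi psi)) :
  forall n : nat, has_rank (commutator phi psi) n -> ~~ odd n.
Proof.
move=> n [b [bV bfree bspan]].
pose K := commutator phi psi.
have /choice[u Hu] i : exists u, L2h_perp u /\ K u = b i by have [u] := bV i; exists u.
have Pu i : L2h_perp (u i) by case: (Hu i).
have Pb i : L2h_perp (b i) by have [_ <-] := Hu i; exact: commutator_perp.
have Lu i := L2h_perp_L2 (Pu i); have Lb i := L2h_perp_L2 (Pb i).
have skew i v : L2h_perp v -> bilin (b i) v = - bilin (K v) (u i).
  by have [_ <-] := Hu i => Hv; exact: commutator_skew.
pose A := \matrix_(i < n, j < n) bilin (b i) (u j).
have Askew : A^T = - A.
  by apply/matrixP => i j; rewrite !mxE skew// ; have [_ ->] := Hu i.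
apply: (skew_unitmx_even Askew); rewrite -row_free_unit -kermx_eq0.
apply/rowV0P => r /sub_kermxP rA.
have rA0 j : \sum_i r 0 i * bilin (b i) (u j) = 0.
  have /matrixP/(_ 0 j) := rA; rewrite !mxE => E.
  by rewrite -[RHS]E; apply: eq_bigr => i _; rewrite mxE.
(* The combination y with coefficients r in the left kernel of A pairs to 0 with
   every u j; its conjugate is the test vector that makes it vanish. *)
pose y z := \sum_(i < n) r 0 i * b i z.
have Py : L2h_perp y by exact: L2h_perp_sum.
have Pyc := L2h_perp_conj Py; have Lyc := L2h_perp_L2 Pyc.
have [d Kyc] : exists d : 'I_n -> R[i], ae_eqD (K (cconj y)) (fun z => \sum_(i < n) d i * b i z).
  by apply: bspan; exists (cconj y).
have LKyc : L2 (K (cconj y)) by apply: L2h_perp_L2; exact: commutator_perp.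
apply/rowP => i; rewrite mxE; apply: (bfree (fun i => r 0 i)).
apply: bilin_conj_eq0; first exact: L2h_perp_L2.
rewrite bilin_suml//.
transitivity (\sum_i \sum_j d j * (r 0 i * bilin (b i) (u j))).
  apply: eq_bigr => k _; rewrite skew// (ae_eq_bilin _ _ _ Kyc)//; last exact: L2_sum.
  rewrite bilin_suml// mulrN -mulNr big_distrr /=; apply: eq_bigr => j _.
  have [_ Kuj] := Hu j; rewrite (skew j)//; have [_ ->] := Hu k; ring.
rewrite exchange_big big1// => j _.
by rewrite -big_distrr /= rA0 mulr0.
Qed.
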